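(* Let $m\ge 1$ and $d\ge 1$ be integers. Let $E^d_m=\max(\ell^m_1)\otimes_h\cdots\otimes_h \max(\ell^m_1)$ ($d$ times), and let $J_{m,d}\colon E^d_m\to \max(\ell^m_2\otimes_2\cdots\otimes_2\ell^m_2)$ ($d$ factors $\ell_2^m$) be the identity map (identifying the canonical tensor bases). Then $$2^{-2(d-1)}\, m^{\frac{d-1}{2}}\le \|J_{m,d}\|_{cb}\le m^{\frac{d-1}{2}}.$$ Moreover, the identity map $Id$ on $E^d_m$ satisfies $$2^{-2(d-1)}\, m^{\frac{d-1}{2}}\le \|Id\colon E^d_m\to \max(E^d_m)\|_{cb}\le m^{\frac{d-1}{2}}.$$
   Context: All spaces are complex. An operator space is a closed subspace of some $B(H)$; $M_n(E)$ carries the induced norm and $\|\cdot\|_{cb}$ is the completely bounded norm. For a normed space $B$, $\max(B)$ is the operator space structure on $B$ given by $\|x\|_{M_n(\max(B))}=\sup\|(I\otimes u)(x)\|_{M_n(B(H))}$, the supremum over all Hilbert spaces $H$ and all linear $u\colon B\to B(H)$ with $\|u\|\le 1$; equivalently every linear $u\colon \max(B)\to B(H)$ satisfies $\|u\|_{cb}=\|u\|$. For an operator space $E$, $\max(E)$ means $\max$ of the underlying normed space. $\otimes_h$ is the (associative) Haagerup tensor product of operator spaces: for $x\in M_n(E\otimes F)$, $\|x\|_h=\inf\{\|a\|_{M_{n,p}(E)}\|b\|_{M_{p,n}(F)}\}$ over all $p$ and all factorizations $x_{ij}=\sum_{k=1}^p a_{ik}\otimes b_{kj}$ (then completed). $\otimes_2$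 is the Hilbert space tensor product. $\ell_p^m$ is $\mathbb{C}^m$ with the $\ell_p$ norm. *)

(* Defs.v *)
From HB Require Import structures.
From mathcomp Require Import all_boot all_order all_algebra.
From mathcomp Require Import all_classical all_reals all_analysis.
From mathcomp Require Import complex.
Import Order.TTheory GRing.Theory Num.Theory numFieldNormedType.Exports.

Set Implicit Arguments.
Unset Strict Implicit.
Unset Printing Implicit Defensive.

Local Open Scope classical_set_scope.
Local Open Scope ring_scope.

(* In MathComp norms over the scalar field R[i] take values in R[i]; [rnorm]
   is the same norm, read in R. *)
Definition rnorm (R : realType) (V : normedZmodType R[i]) (x : V) : R :=
  complex.Re `|x|.

(* The inner product is linear on the left and conjugate-linear on the right. *)
Record hilbertSpace (R : realType) := HilbertSpace {
  hilbert_sort :> completeNormedModType R[i];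
  hdot : {dot hilbert_sort for Num.conj};
  hdotE : forall x : hilbert_sort, `|x| ^+ 2 = hdot x x
}.

(* The norm of the Hilbert space H^n. *)
Definition hvec_norm (R : realType) (H : hilbertSpace R) (n : nat)
    (h : 'I_n -> H) : R :=
  Num.sqrt (\sum_(i < n) rnorm (h i) ^+ 2).

Definition opnorm (R : realType) (H : hilbertSpace R) (T : H -> H) : \bar R :=
  ereal_sup [set (rnorm (T h))%:E | h in [set h : H | rnorm h <= 1]].

(* T belongs to B(H). *)
Definition bounded_op (R : realType) (H : hilbertSpace R) (T : H -> H) : Prop :=
  linear T /\ (opnorm T < +oo)%E.

(* The norm of M_{n,p}(B(H)) = B(H^p, H^n). *)
Definition opnorm_mx (R : realType) (H : hilbertSpace R) (n p : nat)
    (T : 'M[H -> H]_(n, p)) : \bar R :=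
  ereal_sup [set (hvec_norm (fun i => \sum_(j < p) T i j (h j)))%:E
            | h in [set h : 'I_p -> H | hvec_norm h <= 1]].

(* The norms of all the spaces M_{n,p}(E) of an operator space E with
   underlying vector space V; a rectangular matrix has the norm it gets when
   padded with zeros to a square one, i.e. its norm as an operator from H^p to
   H^n when E sits in B(H).  Suprema and infima are taken in \bar R, so that
   no finiteness has to be proved beforehand. *)
Definition mxnorms (R : realType) (V : lmodType R[i]) : Type :=
  forall n p : nat, 'M[V]_(n, p) -> \bar R.

Definition base_norm (R : realType) (V : lmodType R[i]) (E : mxnorms V)
    (x : V) : \bar R :=
  E 1%N 1%N (const_mx x).

Definition cbnorm (R : realType) (V W : lmodType R[i])
    (E : mxnorms V) (F : mxnorms W) (u : {linear V -> W}) : \bar R :=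
  ereal_sup [set r | exists (n : nat) (x : 'M[V]_n),
    (E n n x <= 1)%E /\ r = F n n (map_mx u x)].

(* The norm of a linear map from V, normed by N, to B(H). *)
Definition lin_norm (R : realType) (V : lmodType R[i]) (N : V -> \bar R)
    (H : hilbertSpace R) (u : {linear V -> (H -> H)}) : \bar R :=
  ereal_sup [set opnorm (u b) | b in [set b : V | (N b <= 1)%E]].

Definition max_os (R : realType) (V : lmodType R[i]) (N : V -> \bar R) :
    mxnorms V :=
  fun n p x => ereal_sup [set r |
    exists (H : hilbertSpace R) (u : {linear V -> (H -> H)}),
    [/\ forall b, bounded_op (u b),
        (lin_norm N u <= 1)%E
      & r = opnorm_mx (map_mx u x)]].

(* C^I (x) C^J is identified with C^(I * J), e_i (x) e_j being e_(i, j). *)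
Definition tens (R : realType) (I J : finType)
    (v : {ffun I -> R[i]}) (w : {ffun J -> R[i]}) : {ffun I * J -> R[i]} :=
  [ffun k => v k.1 * w k.2].

(* All the spaces are finite-dimensional here, so there is nothing to
   complete. *)
Definition haagerup (R : realType) (I J : finType)
    (E : mxnorms {ffun I -> R[i]}) (F : mxnorms {ffun J -> R[i]}) :
    mxnorms {ffun I * J -> R[i]} :=
  fun n q x => ereal_inf [set r |
    exists (p : nat) (a : 'M[{ffun I -> R[i]}]_(n, p))
           (b : 'M[{ffun J -> R[i]}]_(p, q)),
    (forall i j, x i j = \sum_(k < p) tens (a i k) (b k j)) /\
    r = (E n p a * F p q b)%E].

(* The index set of the canonical basis of the tensor product of k + 1 copies
   of C^I. *)
Fixpoint tpow_idx (I : finType) (k : nat) : finType :=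
  if k is k'.+1 then (tpow_idx I k' * I)%type else I.

(* The Haagerup tensor product of k + 1 copies of E. *)
Fixpoint haagerup_pow (R : realType) (I : finType)
    (E : mxnorms {ffun I -> R[i]}) (k : nat) :
    mxnorms {ffun tpow_idx I k -> R[i]} :=
  match k return mxnorms {ffun tpow_idx I k -> R[i]} with
  | 0 => E
  | k'.+1 => haagerup (@haagerup_pow R I E k') E
  end.

Definition ell1_norm (R : realType) (m : nat) (x : {ffun 'I_m -> R[i]}) : R :=
  \sum_(i < m) rnorm (x i).

Definition ell2_dot (R : realType) (m : nat) (x y : {ffun 'I_m -> R[i]}) :
    R[i] :=
  \sum_(i < m) x i * Num.conj (y i).

Definition basis_vec (R : realType) (I : finType) (i : I) : {ffun I -> R[i]} :=
  [ffun j => (i == j)%:R].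

(* The sesquilinear form on C^I (x) C^J determined by
   <v (x) w, v' (x) w'> = <v, v'> <w, w'>, expanded in the basis e_i (x) e_j. *)
Definition tens_dot (R : realType) (I J : finType)
    (f : {ffun I -> R[i]} -> {ffun I -> R[i]} -> R[i])
    (g : {ffun J -> R[i]} -> {ffun J -> R[i]} -> R[i])
    (x y : {ffun I * J -> R[i]}) : R[i] :=
  \sum_(k : I * J) \sum_(l : I * J) x k * Num.conj (y l) *
    (f (basis_vec R k.1) (basis_vec R l.1) *
     g (basis_vec R k.2) (basis_vec R l.2)).

Fixpoint tens_dot_pow (R : realType) (I : finType)
    (f : {ffun I -> R[i]} -> {ffun I -> R[i]} -> R[i]) (k : nat) :
    {ffun tpow_idx I k -> R[i]} -> {ffun tpow_idx I k -> R[i]} -> R[i] :=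
  match k return
    {ffun tpow_idx I k -> R[i]} -> {ffun tpow_idx I k -> R[i]} -> R[i] with
  | 0 => f
  | k'.+1 => tens_dot (@tens_dot_pow R I f k') f
  end.

Definition dot_norm (R : realType) (V : lmodType R[i]) (f : V -> V -> R[i])
    (x : V) : R :=
  Num.sqrt (complex.Re (f x x)).

(* E^d_m; only meant for d >= 1. *)
Definition Emd (R : realType) (m d : nat) :
    mxnorms {ffun tpow_idx 'I_m d.-1 -> R[i]} :=
  haagerup_pow (k := d.-1)
    (max_os (fun x : {ffun 'I_m -> R[i]} => (ell1_norm x)%:E)).

Arguments Emd R m d : clear implicits.

(* The norm of the Hilbert tensor product of d copies of l_2^m; only meant for
   d >= 1. *)
Definition ell2_tens_norm (R : realType) (m d : nat)
    (x : {ffun tpow_idx 'I_m d.-1 -> R[i]}) : R :=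
  dot_norm (tens_dot_pow (k := d.-1) (@ell2_dot R m)) x.

Arguments ell2_tens_norm R m d x : clear implicits.

(* Main.v *)
From HB Require Import structures.
Require Import Defs.
From mathcomp Require Import all_boot all_order all_algebra.
From mathcomp Require Import fingroup perm cyclic.
From mathcomp Require Import all_classical all_reals all_analysis.
From mathcomp Require Import complex ring lra zify.
From mathcomp Require separable cyclotomic.
Import Order.TTheory GRing.Theory Num.Theory numFieldNormedType.Exports.

Set Implicit Arguments.
Unset Strict Implicit.
Unset Printing Implicit Defensive.

Local Open Scope classical_set_scope.
Local Open Scope ring_scope.

(** Write E for the d-fold Haagerup tensor power of max(l_1^m), with d >= 1.

    Reduction.  The identity of max(l_1^m) into the column Hilbert space C^m is
    completely contractive ([max_os_col]), and column spaces multiply under the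
    Haagerup product ([haagerup_col]), so the norm of E dominates the l_2 norm
    ([l2_le_tower]).  Every contraction for the l_2 norm is then one for the
    norm of E, hence the cb norm of J is at most the cb norm of
    Id : E -> max(E) ([cbnorm_max_mono]), and it is enough to bound the first
    from below and the second from above.

    Upper bound.  Let u be a contraction from E' (x) max(l_1^m) to B(H), and
    let x = a . b be a factorization as in the definition of the Haagerup norm.
    Expanding b = sum_j b_j (x) e_j gives u(x) = sum_j u_j(a) b_j with
    u_j = u(. (x) e_j) again contractive on E'.  The m summands cost a factor
    sqrt m by Cauchy-Schwarz as soon as the column of the b_j is controlled, and
    it is, because max(l_1^m) maps to the column space.  Each of the d - 1
    Haagerup products thus costs sqrt m ([haagerup_extension]).

    Lower bound.  For d >= 2 the test element is
      X = sum_I e_I (x) s phi(I) u_{i_1} u_{i_2} ... u_{i_d},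
    I running over the multi-indices (i_1, ..., i_d), where the u's are
    permutation operators on l_2^n (two families, used for letters at even and
    at odd places) and phi(I) is the product of the Fourier entries
    z^(i_l i_{l+1}).  Written as row . diagonal . Fourier . diagonal ... column,
    X has norm at most |s| m^((d+1)/2) in M_n(E), since the unnormalised
    Fourier matrix has norm sqrt m ([test_mx_norm]).  The functional that
    detects X sends e_I to conj(phi(I)) u_{i_1} ... u_{i_d} Q / M, where Q is a
    projection of l_2^n; evaluating on the maximally entangled vector gives
    s m^d tr(Q) / (n M) ([pairing]), so that the ratio is
    m^((d-1)/2) tr(Q) / (n M).  It remains to choose the permutations so that
    this functional is a contraction on l_2, with M and Q as good as possible.

    For free involutions Haagerup's inequality gives M = d + 1 and Q = 1
    ([haagerup_inequality]): in a product of a reduced word of length d with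
    another word, the number of cancelled letters takes d + 1 values, and for
    each of them Cauchy-Schwarz applies.  Finitely many permutations with no
    short relations exist ([large_girth]), and for these the inequality holds
    for the iterates of the basis vectors of l_2^n ([spread_step]), hence the
    high moments of T^* T, for T = sum_w b_w w, are as small as in the free
    case.  Consequently all but a small proportion of the singular values of T
    are not much larger than (d + 1) |b|.  The exceptions can be removed
    simultaneously for a finite net of coefficients b ([trimming]), which leaves
    M = d + 5/3 with tr(Q) >= 11 n / 12 ([nearly_free]).  Finally
    d + 5/3 <= (11/12) 4^(d-1) for d >= 2 ([four_pow_ge]).  For d = 1 the lower
    bound is 1 and a basis vector attains it. *)

(** * Real-valued norms and completeness of the scalars *)
Section RealNorm.
Variable R : realType.
Implicit Types V : normedZmodType R[i].

Lemma rnormC V (x : V) : (rnorm x)%:C%C = `|x|.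
Proof.
by rewrite /rnorm; apply: RRe_real; rewrite ger0_real // normr_ge0.
Qed.

Lemma rnorm_ge0 V (x : V) : 0 <= rnorm x.
Proof. by rewrite -lecR rnormC normr_ge0. Qed.

Lemma rnormD V (x y : V) : rnorm (x + y) <= rnorm x + rnorm y.
Proof. by rewrite -lecR rmorphD /= !rnormC ler_normD. Qed.

Lemma rnorm_eq0 V (x : V) : rnorm x = 0 -> x = 0.
Proof. by move=> x0; apply/eqP; rewrite -normr_eq0 -rnormC x0. Qed.

Lemma rnorm0 V : rnorm (0 : V) = 0.
Proof. by rewrite /rnorm normr0. Qed.

Lemma rnorm_sum V (I : Type) (r : seq I) (P : pred I) (f : I -> V) :
  rnorm (\sum_(i <- r | P i) f i) <= \sum_(i <- r | P i) rnorm (f i).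
Proof.
elim/big_ind2: _ => [|x a y b xa yb|//]; first by rewrite rnorm0.
by apply: le_trans (rnormD _ _) _; exact: lerD.
Qed.

Lemma rnormM (a b : R[i]) : rnorm (a * b) = rnorm a * rnorm b.
Proof. by apply: (@complexI R); rewrite rmorphM /= !rnormC normrM. Qed.

Lemma rnorm_conj (a : R[i]) : rnorm (Num.conj a) = rnorm a.
Proof. by rewrite /rnorm norm_conjC. Qed.

Lemma rnorm1 : rnorm (1 : R[i]) = 1.
Proof. by rewrite /rnorm normr1. Qed.

Lemma rnorm_real (x : R) : rnorm (x%:C%C : R[i]) = `|x|.
Proof. by rewrite /rnorm normc_def /= expr0n addr0 sqrtr_sqr. Qed.

Lemma conj_mul (a : R[i]) : a * Num.conj a = (rnorm a ^+ 2)%:C%C.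
Proof. by rewrite -normCK -rnormC rmorphXn. Qed.

Lemma rnormZ (V : normedModType R[i]) (a : R[i]) (x : V) :
  rnorm (a *: x) = rnorm a * rnorm x.
Proof. by apply: (@complexI R); rewrite rmorphM /= !rnormC normrZ. Qed.

End RealNorm.

Section Filters.
Variable R : realType.

Lemma cauchy_rnorm (V : normedModType R[i]) (F : set_system V) (e : R) :
  ProperFilter F -> cauchy F -> 0 < e ->
  exists x : V, F [set y | rnorm (x - y) < e].
Proof.
move=> FF Fc e0; have [|x Fx] := (cauchyP F).1 Fc e%:C%C; first by rewrite ltcR.
exists x; apply: filterS Fx => y.
by rewrite -ball_normE /ball_ /= -rnormC ltcR.
Qed.

Lemma cvg_rnorm (V : normedModType R[i]) (F : set_system V) (l : V) :
  ProperFilter F -> (forall e : R, 0 < e -> F [set y | rnorm (l - y) < e]) ->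
  cvg F.
Proof.
move=> FF Fl; apply/cvg_ex; exists l; apply/cvgrPdist_lt => e e0.
have eE : e = (complex.Re e)%:C%C by rewrite RRe_real // ger0_real // ltW.
have := Fl (complex.Re e); rewrite -ltcR -eE => /(_ e0).
by apply: filterS => y /=; rewrite -ltcR -eE rnormC.
Qed.

End Filters.

Section Scalars.
Variable R : realType.

(** The field R[i] as a Hilbert space needs completeness; putting that instance
    on an alias keeps the instances of R[i] itself untouched. *)
Definition scalars := (R[i])^o.
HB.instance Definition _ := NormedModule.on scalars.

Lemma Re_norm_le (x : R[i]) : `|complex.Re x| <= complex.Re `|x|.
Proof.
by have := normc_ge_Re x; rewrite -lecR RRe_real // ger0_real ?normr_ge0.
Qed.

Lemma Im_norm_le (x : R[i]) : `|complex.Im x| <= complex.Re `|x|.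
Proof. by rewrite normc_def /= -sqrtr_sqr ler_wsqrtr // lerDr sqr_ge0. Qed.

Lemma norm_le_ReIm (x : R[i]) :
  complex.Re `|x| <= `|complex.Re x| + `|complex.Im x|.
Proof.
rewrite normc_def /= -[leRHS]ger0_norm ?addr_ge0 // -sqrtr_sqr ler_wsqrtr //.
by rewrite sqrrD !real_normK ?num_real // lerD2r lerDl mulrn_wge0 // mulr_ge0.
Qed.

(** Real and imaginary parts are 1-Lipschitz, so they converge separately. *)
Lemma scalars_complete (F : set_system scalars) :
  ProperFilter F -> cauchy F -> cvg F.
Proof.
move=> FF Fc.
have cauchy_part (p : R[i] -> R) : (forall x y, p (x - y) = p x - p y) ->
    (forall x, `|p x| <= complex.Re `|x|) ->
    cvg ((p : scalars -> R) @ F).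
  move=> pB p_le; apply: R_complete; apply/cauchyP => e e0.
  have [x Fx] := cauchy_rnorm FF Fc e0.
  exists (p x); change (F (p @^-1` ball (p x) e)); apply: filterS Fx => y /= xy.
  rewrite -ball_normE; change (`|p x - p y| < e); rewrite -pB.
  by apply: le_lt_trans (p_le _) _; exact: xy.
have /cvg_ex[a Fa] := cauchy_part (@complex.Re R) ltac:(by case=> ? ? []) Re_norm_le.
have /cvg_ex[b Fb] := cauchy_part (@complex.Im R) ltac:(by case=> ? ? []) Im_norm_le.
apply: (@cvg_rnorm R scalars F (a +i* b)%C FF) => e e0.
have e2 : 0 < e / 2 by rewrite divr_gt0.
move/cvgrPdist_lt/(_ _ e2) : Fa => Fa.
move/cvgrPdist_lt/(_ _ e2) : Fb => Fb.
near=> z; rewrite /= /rnorm; apply: le_lt_trans (norm_le_ReIm _) _.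
rewrite [ltRHS]splitr; apply: ltrD; near: z.
  apply: filterS Fa => -[x y]; exact.
apply: filterS Fb => -[x y]; exact.
Unshelve. all: by end_near. Qed.

HB.instance Definition _ := Uniform_isComplete.Build scalars scalars_complete.
End Scalars.

(** * Finite l2 sums *)
Section L2.
Variable R : rcfType.

Definition l2 (I : Type) (r : seq I) (f : I -> R) : R :=
  Num.sqrt (\sum_(i <- r) f i ^+ 2).

Lemma sum_sqr_ge0 (I : Type) (r : seq I) (P : pred I) (f : I -> R) :
  0 <= \sum_(i <- r | P i) f i ^+ 2.
Proof. by apply: sumr_ge0 => i _; exact: sqr_ge0. Qed.

Lemma l2_ge0 (I : Type) (r : seq I) (f : I -> R) : 0 <= l2 r f.
Proof. exact: sqrtr_ge0. Qed.

Lemma sqr_l2 (I : Type) (r : seq I) (f : I -> R) :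
  l2 r f ^+ 2 = \sum_(i <- r) f i ^+ 2.
Proof. by rewrite sqr_sqrtr // sum_sqr_ge0. Qed.

Lemma sum_mul_le_l2 (I : Type) (r : seq I) (f g : I -> R) :
  \sum_(i <- r) f i * g i <= l2 r f * l2 r g.
Proof.
elim: r => [|i r IH]; first by rewrite big_nil mulr_ge0 ?l2_ge0.
rewrite big_cons; apply: le_trans (lerD (lexx _) IH) _.
rewrite {3 4}/l2 !big_cons -!sqr_l2 -[leRHS]sqrtrM ?addr_ge0 ?sqr_ge0 //.
apply: le_trans (ler_norm _) _; rewrite -sqrtr_sqr ler_wsqrtr //.
set a := f i; set b := g i; set c := l2 r f; set d := l2 r g.
rewrite -subr_ge0; have -> : (a ^+ 2 + c ^+ 2) * (b ^+ 2 + d ^+ 2) -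
  (a * b + c * d) ^+ 2 = (a * d - b * c) ^+ 2 by ring.
exact: sqr_ge0.
Qed.

Lemma l2_le (I : Type) (r : seq I) (f g : I -> R) :
  (forall i, 0 <= f i <= g i) -> l2 r f <= l2 r g.
Proof.
move=> fg; rewrite /l2 ler_wsqrtr // ler_sum // => i _.
by have /andP[f0 fg1] := fg i; rewrite lerXn2r // ?nnegrE // (le_trans f0).
Qed.

Lemma l2D (I : Type) (r : seq I) (f g : I -> R) :
  l2 r (fun i => f i + g i) <= l2 r f + l2 r g.
Proof.
rewrite -(@ler_pXn2r _ 2) ?nnegrE ?addr_ge0 ?l2_ge0 // sqrrD !sqr_l2.
under eq_bigr do rewrite sqrrD.
rewrite !big_split /= -mulr2n lerD2r lerD2l lerMn2r /=.
exact: sum_mul_le_l2.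
Qed.

Lemma l2Z (I : Type) (r : seq I) (f : I -> R) (c : R) : 0 <= c ->
  l2 r (fun i => c * f i) = c * l2 r f.
Proof.
move=> c0; rewrite /l2; under eq_bigr do rewrite exprMn.
by rewrite -mulr_sumr sqrtrM ?sqr_ge0 // sqrtr_sqr ger0_norm.
Qed.

Lemma l2_le_sum (I : Type) (r : seq I) (f : I -> R) :
  (forall i, 0 <= f i) -> l2 r f <= \sum_(i <- r) f i.
Proof.
move=> f0; rewrite -(@ler_pXn2r _ 2) ?nnegrE ?l2_ge0 ?sumr_ge0 // sqr_l2.
elim: r => [|i r IH]; first by rewrite !big_nil expr0n.
rewrite !big_cons sqrrD -addrA lerD2l; apply: le_trans IH _.
by rewrite lerDr mulrn_wge0 // mulr_ge0 // sumr_ge0.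
Qed.

Lemma l2_sum (I J : Type) (r : seq I) (s : seq J) (f : J -> I -> R) :
  l2 r (fun i => \sum_(j <- s) f j i) <= \sum_(j <- s) l2 r (f j).
Proof.
elim: s => [|j s IH].
  rewrite big_nil /l2 big1 ?sqrtr0 // => i _; rewrite big_nil expr0n //.
rewrite big_cons; apply: le_trans (lerD (lexx _) IH).
suff -> : l2 r (fun i => \sum_(j <- j :: s) f j i) =
  l2 r (fun i => f j i + \sum_(j <- s) f j i) by exact: l2D.
by rewrite /l2; under eq_bigr do rewrite big_cons.
Qed.

End L2.

(** * Hilbert spaces *)
Section Hilbert.
Variables (R : realType) (H : hilbertSpace R).
Implicit Types x y z : H.

Lemma dotDl x y z : hdot H (x + y) z = hdot H x z + hdot H y z.
Proof. exact: linearDl. Qed.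
Lemma dotDr x y z : hdot H z (x + y) = hdot H z x + hdot H z y.
Proof. exact: linearDr. Qed.
Lemma dotBl x y z : hdot H (x - y) z = hdot H x z - hdot H y z.
Proof. exact: linearBl. Qed.
Lemma dotBr x y z : hdot H z (x - y) = hdot H z x - hdot H z y.
Proof. exact: linearBr. Qed.
Lemma dot0l x : hdot H 0 x = 0.
Proof. exact: linear0l. Qed.
Lemma dotZl a x z : hdot H (a *: x) z = a * hdot H x z.
Proof. exact: linearZl_LR. Qed.
Lemma dotZr a x z : hdot H z (a *: x) = Num.conj a * hdot H z x.
Proof. exact: linearZr_LR. Qed.
Lemma dotC x y : hdot H x y = Num.conj (hdot H y x).
Proof. by rewrite {1}hermC expr0 mul1r. Qed.
Lemma dot_suml (I : Type) (r : seq I) (P : pred I) (f : I -> H) z :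
  hdot H (\sum_(i <- r | P i) f i) z = \sum_(i <- r | P i) hdot H (f i) z.
Proof. exact: linear_sumlz. Qed.
Lemma dot_sumr (I : Type) (r : seq I) (P : pred I) (f : I -> H) z :
  hdot H z (\sum_(i <- r | P i) f i) = \sum_(i <- r | P i) hdot H z (f i).
Proof. exact: linear_sumr. Qed.

Lemma dotxx x : hdot H x x = (rnorm x ^+ 2)%:C%C.
Proof. by rewrite -hdotE -rnormC rmorphXn. Qed.

Lemma Cauchy_Schwarz x y : rnorm (hdot H x y) <= rnorm x * rnorm y.
Proof.
have [y0|yN0] := eqVneq (rnorm y) 0.
  by rewrite (rnorm_eq0 y0) dotC dot0l rmorph0 !rnorm0 mulr0.
set a := hdot H x y; set b := (rnorm y ^+ 2)%:C%C.
have bR : Num.conj b = b by apply/CrealP; rewrite complex_real.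
pose z := b *: x - a *: y.
have : 0 <= hdot H z z by rewrite dotxx ler0c sqr_ge0.
have -> : hdot H z z = b * (b * hdot H x x - a * Num.conj a).
  rewrite /z dotBl !dotBr !dotZl !dotZr bR -/a [hdot H y x]dotC -/a.
  by rewrite (dotxx y) -/b; ring.
rewrite conj_mul dotxx /b -!rmorphM -rmorphB -rmorphM ler0c.
rewrite pmulr_rge0; last by rewrite exprn_gt0 // lt_def yN0 rnorm_ge0.
rewrite subr_ge0 -exprMn mulrC.
by rewrite ler_pXn2r ?nnegrE ?rnorm_ge0 ?mulr_ge0 ?rnorm_ge0.
Qed.

End Hilbert.

Section ScalarHilbert.
Variable R : realType.

Definition scalar_dot (x y : scalars R) : R[i] := x * Num.conj y.

Lemma scalar_dot_bilinear :
  bilinear_for (GRing.Scale.Law.clone _ _ *%R _)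
    (GRing.Scale.Law.clone _ _ (Num.conj \; *%R) _) scalar_dot.
Proof.
split=> [y|x] a u v; rewrite /scalar_dot.
  by rewrite mulrDl -mulrA.
by rewrite rmorphD rmorphM mulrDr mulrCA.
Qed.
HB.instance Definition _ :=
  bilinear_isBilinear.Build _ _ _ _ _ _ scalar_dot scalar_dot_bilinear.

Lemma scalar_dot_hermitian (x y : scalars R) :
  scalar_dot x y = (-1) ^+ false * Num.conj (scalar_dot y x).
Proof. by rewrite /scalar_dot expr0 mul1r rmorphM /= conjCK mulrC. Qed.
HB.instance Definition _ :=
  isHermitianSesquilinear.Build _ _ _ _ scalar_dot scalar_dot_hermitian.

Lemma scalar_dot_gt0 (x : scalars R) : x != 0 -> 0 < scalar_dot x x.
Proof. by move=> x0; rewrite /scalar_dot mul_conjC_gt0. Qed.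
HB.instance Definition _ :=
  isDotProduct.Build _ _ scalar_dot scalar_dot_gt0.

Lemma scalar_dotE (x : scalars R) : `|x| ^+ 2 = scalar_dot x x.
Proof. exact: normCK. Qed.

Definition scalar_hilbert : hilbertSpace R := HilbertSpace scalar_dotE.

End ScalarHilbert.

Section HilbertSum.
Variables (R : realType) (H : hilbertSpace R) (I : finType).

(** The Hilbert sum of copies of H indexed by I.  With H = C it is l_2(I), and
    with I = option J it is the space on which a column of operators lives. *)
Definition hsum := {ffun I -> H}.
HB.instance Definition _ := GRing.Lmodule.on hsum.
Implicit Types x y : hsum.

Definition hsum_rnorm x : R := l2 (enum I) (fun i => rnorm (x i)).
Definition hsum_norm x : R[i] := (hsum_rnorm x)%:C%C.

Lemma hsum_normD x y : hsum_norm (x + y) <= hsum_norm x + hsum_norm y.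
Proof.
rewrite -rmorphD lecR; apply: le_trans (l2D _ _ _).
by apply: l2_le => i; rewrite rnorm_ge0 ffunE rnormD.
Qed.

Lemma hsum_normZ (a : R[i]) x : hsum_norm (a *: x) = `|a| * hsum_norm x.
Proof.
rewrite /hsum_norm /hsum_rnorm -rnormC -rmorphM -l2Z ?rnorm_ge0 //.
by congr (_%:C%C); rewrite /l2; under eq_bigr do rewrite ffunE rnormZ.
Qed.

Lemma hsum_coord_le x i : rnorm (x i) <= hsum_rnorm x.
Proof.
rewrite -[leLHS]ger0_norm ?rnorm_ge0 // -sqrtr_sqr ler_wsqrtr //.
rewrite (bigD1_seq i) ?mem_enum ?enum_uniq //= lerDl sum_sqr_ge0 //.
Qed.

Lemma hsum_norm0 x : hsum_norm x = 0 -> x = 0.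
Proof.
move=> [x0]; apply/ffunP => i; rewrite ffunE; apply: rnorm_eq0.
by apply/eqP; rewrite eq_le rnorm_ge0 andbT -x0 hsum_coord_le.
Qed.

HB.instance Definition _ := Lmodule_isNormed.Build R[i] hsum
  hsum_normD hsum_normZ hsum_norm0.

Lemma rnorm_hsum x : rnorm x = hsum_rnorm x.
Proof. by []. Qed.

Lemma hsum_complete (F : set_system hsum) :
  ProperFilter F -> cauchy F -> cvg F.
Proof.
move=> FF Fc.
have coord_cvg i : cvg ((fun x : hsum => x i) @ F).
  apply: cauchy_cvg; apply/cauchyP => e e0.
  have eE : e = (complex.Re e)%:C%C by rewrite RRe_real // ger0_real // ltW.
  have e0' : 0 < complex.Re e by rewrite -ltcR -eE.
  have [x Fx] := cauchy_rnorm FF Fc e0'.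
  exists (x i); change (F ((fun x : hsum => x i) @^-1` ball (x i) e)).
  apply: filterS Fx => y /= xy; rewrite -ball_normE /ball_ /= eE -rnormC ltcR.
  apply: le_lt_trans xy; rewrite rnorm_hsum.
  by have := hsum_coord_le (x - y) i; rewrite !ffunE.
pose l : hsum := [ffun i => lim ((fun x : hsum => x i) @ F)].
apply: (@cvg_rnorm R hsum F l FF) => e e0.
pose d := e / (#|I|%:R + 1).
have d0 : 0 < d by rewrite divr_gt0 // ltr_wpDl.
have Fd i : F [set x : hsum | rnorm (l i - x i) < d].
  have := coord_cvg i; move/cvgrPdist_lt => /(_ d%:C%C).
  rewrite ltcR => /(_ d0); apply: filterS => x /=.
  by rewrite -rnormC ltcR ffunE.
have : F [set x : hsum | forall i, rnorm (l i - x i) < d].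
  exact: filter_forall.
apply: filterS => x xd /=; rewrite rnorm_hsum /hsum_rnorm.
apply: (@le_lt_trans _ _ (\sum_(i <- enum I) d)); last first.
  rewrite big_const_seq count_predT -cardE iter_addr addr0 -mulr_natr /d.
  by rewrite mulrAC ltr_pdivrMr ?ltr_wpDl // ltr_pM2l // ltrDl.
apply: le_trans (l2_le_sum _ _) _ => [i|]; first exact: rnorm_ge0.
by apply: ler_sum => i _; rewrite !ffunE; apply: ltW; have := xd i; rewrite ffunE.
Qed.

HB.instance Definition _ := Uniform_isComplete.Build hsum hsum_complete.

Definition hsum_dot x y : R[i] := \sum_i hdot H (x i) (y i).

Lemma hsum_dot_bilinear :
  bilinear_for (GRing.Scale.Law.clone _ _ *%R _)
    (GRing.Scale.Law.clone _ _ (Num.conj \; *%R) _) hsum_dot.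
Proof.
split=> [y|x] a u v; rewrite /hsum_dot /= mulr_sumr -big_split /=.
  by apply: eq_bigr => i _; rewrite !ffunE dotDl dotZl.
by apply: eq_bigr => i _; rewrite !ffunE dotDr dotZr.
Qed.
HB.instance Definition _ :=
  bilinear_isBilinear.Build _ _ _ _ _ _ hsum_dot hsum_dot_bilinear.

Lemma hsum_dot_hermitian x y :
  hsum_dot x y = (-1) ^+ false * Num.conj (hsum_dot y x).
Proof.
rewrite expr0 mul1r rmorph_sum; apply: eq_bigr => i _; exact: dotC.
Qed.
HB.instance Definition _ :=
  isHermitianSesquilinear.Build _ _ _ _ hsum_dot hsum_dot_hermitian.

Lemma hsum_dotE x : `|x| ^+ 2 = hsum_dot x x.
Proof.
rewrite -rnormC rnorm_hsum -rmorphXn sqr_l2 rmorph_sum big_enum /=.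
by apply: eq_bigr => i _; rewrite dotxx.
Qed.

Lemma hsum_dot_gt0 x : x != 0 -> 0 < hsum_dot x x.
Proof. by move=> x0; rewrite -hsum_dotE exprn_gt0 // normr_gt0. Qed.
HB.instance Definition _ :=
  isDotProduct.Build _ _ hsum_dot hsum_dot_gt0.

Definition hsum_hilbert : hilbertSpace R := HilbertSpace hsum_dotE.

End HilbertSum.

(** * Matrices of operators and maximal operator spaces *)
Section Operators.
Variables (R : realType) (H : hilbertSpace R).

Definition hnorm (J : finType) (h : J -> H) : R :=
  l2 (index_enum J) (fun j => rnorm (h j)).

Lemma hnorm_ge0 (J : finType) (h : J -> H) : 0 <= hnorm h.
Proof. exact: l2_ge0. Qed.

Lemma hnorm0 (J : finType) (h : J -> H) : (forall j, h j = 0) -> hnorm h = 0.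
Proof.
by move=> h0; rewrite /hnorm /l2 big1 ?sqrtr0 // => j _; rewrite h0 rnorm0 expr0n.
Qed.

Lemma hnorm_eq0 (J : finType) (h : J -> H) : hnorm h = 0 -> forall j, h j = 0.
Proof.
move=> /eqP; rewrite sqrtr_eq0 => h0 j; apply: rnorm_eq0; apply/eqP.
rewrite -sqrf_eq0 eq_le sqr_ge0 andbT; apply: le_trans h0.
by rewrite (bigD1 j) //= lerDl sum_sqr_ge0.
Qed.

Lemma hnormZ (J : finType) (a : R[i]) (h : J -> H) :
  hnorm (fun j => a *: h j) = rnorm a * hnorm h.
Proof.
rewrite /hnorm -l2Z ?rnorm_ge0 //; congr (Num.sqrt _).
by apply: eq_bigr => j _; rewrite rnormZ.
Qed.

Definition as_linear (T : H -> H) (T_lin : linear T) : {linear H -> H} :=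
  HB.pack T (GRing.isLinear.Build _ _ _ _ T T_lin).

Lemma lin_sum (T : H -> H) (I : Type) (r : seq I) (P : pred I) (f : I -> H) :
  linear T -> T (\sum_(i <- r | P i) f i) = \sum_(i <- r | P i) T (f i).
Proof. by move=> T_lin; exact: (raddf_sum (as_linear T_lin)). Qed.

Lemma lin0 (T : H -> H) : linear T -> T 0 = 0.
Proof. by move=> T_lin; exact: (raddf0 (as_linear T_lin)). Qed.

Lemma linZ (T : H -> H) (a : R[i]) (h : H) : linear T -> T (a *: h) = a *: T h.
Proof. by move=> T_lin; exact: (linearZ_LR (as_linear T_lin)). Qed.

Definition mxapp n p (T : 'M[H -> H]_(n, p)) (h : 'I_p -> H) (i : 'I_n) : H :=
  \sum_(j < p) T i j (h j).

Lemma opnorm_mxE n p (T : 'M[H -> H]_(n, p)) :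
  opnorm_mx T = ereal_sup [set (hnorm (mxapp T h))%:E
                          | h in [set h : 'I_p -> H | hnorm h <= 1]].
Proof. by []. Qed.

(** Homogeneous form of the definition of the norm.  It holds in extended reals
    without assuming the norm finite: where the norm is infinite and h is 0,
    the product on the right is 0, and so is the left-hand side. *)
Lemma opnorm_mx_le n p (T : 'M[H -> H]_(n, p)) (h : 'I_p -> H) :
  (forall i j, linear (T i j)) ->
  ((hnorm (mxapp T h))%:E <= opnorm_mx T * (hnorm h)%:E)%E.
Proof.
move=> Tlin; have [h0|hN0] := eqVneq (hnorm h) 0.
  rewrite h0 mule0 lee_fin hnorm0 // => i; rewrite /mxapp big1 // => j _.
  by rewrite (hnorm_eq0 h0) lin0.
have hp : 0 < hnorm h by rewrite lt_def hN0 hnorm_ge0.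
pose c : R[i] := ((hnorm h)^-1)%:C%C.
have rc : rnorm c = (hnorm h)^-1 by rewrite rnorm_real ger0_norm // invr_ge0 ltW.
have : ((hnorm (mxapp T (fun j => c *: h j)))%:E <= opnorm_mx T)%E.
  rewrite opnorm_mxE; apply: ereal_sup_ubound; exists (fun j => c *: h j) => //=.
  by rewrite hnormZ rc mulVf.
have -> : mxapp T (fun j => c *: h j) = fun i => c *: mxapp T h i.
  apply/funext => i; rewrite /mxapp scaler_sumr; apply: eq_bigr => j _.
  exact: linZ.
rewrite hnormZ rc => le1.
have -> : hnorm (mxapp T h) = (hnorm h)^-1 * hnorm (mxapp T h) * hnorm h.
  by rewrite mulrAC mulVf // mul1r.
by rewrite EFinM lee_wpmul2r // lee_fin ltW.
Qed.

Lemma opnorm_mx_ge0 n p (T : 'M[H -> H]_(n, p)) : (0 <= opnorm_mx T)%E.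
Proof.
rewrite opnorm_mxE; apply: (@le_trans _ _ (hnorm (mxapp T (fun=> 0)))%:E).
  by rewrite lee_fin hnorm_ge0.
by apply: ereal_sup_ubound; exists (fun=> 0) => //=; rewrite hnorm0.
Qed.

Lemma opnorm_mx_leP n p (T : 'M[H -> H]_(n, p)) (c : R) : 0 <= c ->
  (forall h, hnorm (mxapp T h) <= c * hnorm h) -> (opnorm_mx T <= c%:E)%E.
Proof.
move=> c0 le_c; rewrite opnorm_mxE; apply: ge_ereal_sup => _ [h /= h1 <-].
rewrite lee_fin; apply: le_trans (le_c h) _.
by rewrite -[leRHS]mulr1 ler_wpM2l.
Qed.

Lemma opnorm_leP (T : H -> H) (c : R) : 0 <= c ->
  (forall h, rnorm (T h) <= c * rnorm h) -> (opnorm T <= c%:E)%E.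
Proof.
move=> c0 le_c; apply: ge_ereal_sup => _ [h /= h1 <-].
rewrite lee_fin; apply: le_trans (le_c h) _.
by rewrite -[leRHS]mulr1 ler_wpM2l.
Qed.

Lemma opnorm_le (T : H -> H) (h : H) : linear T ->
  ((rnorm (T h))%:E <= opnorm T * (rnorm h)%:E)%E.
Proof.
move=> Tlin; have [h0|hN0] := eqVneq (rnorm h) 0.
  by rewrite h0 mule0 lee_fin (rnorm_eq0 h0) lin0 // rnorm0.
have hp : 0 < rnorm h by rewrite lt_def hN0 rnorm_ge0.
pose c : R[i] := ((rnorm h)^-1)%:C%C.
have rc : rnorm c = (rnorm h)^-1 by rewrite rnorm_real ger0_norm // invr_ge0 ltW.
have : ((rnorm (T (c *: h)))%:E <= opnorm T)%E.
  by apply: ereal_sup_ubound; exists (c *: h) => //=; rewrite rnormZ rc mulVf.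
rewrite linZ // rnormZ rc => le1.
have -> : rnorm (T h) = (rnorm h)^-1 * rnorm (T h) * rnorm h.
  by rewrite mulrAC mulVf // mul1r.
by rewrite EFinM lee_wpmul2r // lee_fin ltW.
Qed.

Lemma lin_norm_contr (V : lmodType R[i]) (N : V -> \bar R)
    (u : {linear V -> (H -> H)}) (b : V) (h : H) :
  bounded_op (u b) -> (lin_norm N u <= 1)%E -> (N b <= 1)%E ->
  rnorm (u b h) <= rnorm h.
Proof.
move=> [ulin _] u1 b1; rewrite -lee_fin; apply: le_trans (opnorm_le h ulin) _.
rewrite -[leRHS]mul1e lee_wpmul2r ?lee_fin ?rnorm_ge0 //; apply: le_trans u1.
by apply: ereal_sup_ubound; exists b.
Qed.

End Operators.

Section MaxOs.
Variables (R : realType) (V : lmodType R[i]) (N : V -> \bar R).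

Lemma max_os_ge (H : hilbertSpace R) (u : {linear V -> (H -> H)}) n p
    (x : 'M[V]_(n, p)) :
  (forall b, bounded_op (u b)) -> (lin_norm N u <= 1)%E ->
  (opnorm_mx (map_mx u x) <= max_os N x)%E.
Proof. by move=> ub u1; apply: ereal_sup_ubound; exists H, u. Qed.

Lemma max_os_le n p (x : 'M[V]_(n, p)) (c : R) : 0 <= c ->
  (forall (H : hilbertSpace R) (u : {linear V -> (H -> H)}) h,
     (forall b, bounded_op (u b)) -> (lin_norm N u <= 1)%E ->
     hnorm (mxapp (map_mx u x) h) <= c * hnorm h) ->
  (max_os N x <= c%:E)%E.
Proof.
move=> c0 le_c; apply: ge_ereal_sup => _ [H [u [ub u1 ->]]].
by apply: opnorm_mx_leP => // h; exact: le_c.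
Qed.

(** A supremum in extended reals is nonnegative only if the set is inhabited by
    a nonnegative value; the zero map into B(C) provides one. *)
Lemma max_os_ge0 n p (x : 'M[V]_(n, p)) : (0 <= max_os N x)%E.
Proof.
pose H := scalar_hilbert R; pose u : {linear V -> (H -> H)} := \0.
have u0 b : opnorm (u b) = 0%E.
  apply/eqP; rewrite eq_le; apply/andP; split.
    by apply: opnorm_leP => // h; rewrite /= mul0r rnorm0.
  apply: (@le_trans _ _ (rnorm (u b 0))%:E); first by rewrite lee_fin rnorm_ge0.
  by apply: ereal_sup_ubound; exists 0 => //=; rewrite rnorm0.
apply: le_trans (opnorm_mx_ge0 (map_mx u x)) _; apply: max_os_ge.
  move=> b; split; last by rewrite u0.
  by move=> a f g /=; rewrite scaler0 addr0.
by apply: ge_ereal_sup => _ [b _ <-]; rewrite u0.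
Qed.

End MaxOs.

(** * The column Hilbert space *)
Section ColumnMap.
Variables (R : realType) (H : hilbertSpace R) (J : finType).
Local Notation K := (hsum_hilbert H (option J)).
Local Notation V := {ffun J -> R[i]}.

(** An element b of the column space C^J as an operator on H + H^J: it maps the
    H summand, at coordinate None, to the H^J summand by h |-> (b_j h)_j. *)
Definition col_op (b : V) (h : K) : K :=
  [ffun o => if o is Some j then b j *: (h : hsum H (option J)) None else 0].

Lemma col_op_linear : linear (col_op : V -> (K -> K)).
Proof.
move=> a b c; apply/funext => h; apply/ffunP => -[j|]; rewrite !ffunE /=.
  by rewrite scalerDl scalerA.
by rewrite scaler0 addr0.
Qed.
HB.instance Definition _ :=
  GRing.isLinear.Build R[i] V (K -> K) _ col_op col_op_linear.

Definition l2vec (b : V) : R := l2 (index_enum J) (fun j => rnorm (b j)).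

Lemma big_option (T : nmodType) (f : option J -> T) :
  \sum_o f o = f None + \sum_j f (Some j).
Proof.
rewrite (bigD1 None) //=; congr (_ + _).
rewrite (reindex_omap Some id) //=; last by case.
by apply: eq_bigl => j; rewrite eqxx.
Qed.

Lemma rnorm_option (h : hsum H (option J)) :
  rnorm h = Num.sqrt (rnorm (h None) ^+ 2 + \sum_j rnorm (h (Some j)) ^+ 2).
Proof. by rewrite rnorm_hsum /hsum_rnorm /l2 big_enum /= big_option. Qed.

Lemma rnorm_col_op (b : V) (h : hsum H (option J)) :
  rnorm (col_op b h : hsum H (option J)) = l2vec b * rnorm (h None).
Proof.
rewrite rnorm_option !ffunE rnorm0 expr0n add0r.
rewrite /l2vec mulrC -l2Z ?rnorm_ge0 //; congr Num.sqrt.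
by apply: eq_bigr => j _; rewrite ffunE rnormZ mulrC.
Qed.

Lemma rnorm_None_le (h : hsum H (option J)) : rnorm (h None) <= rnorm h.
Proof. exact: (hsum_coord_le h None). Qed.

Lemma col_op_bounded (b : V) : bounded_op (col_op b).
Proof.
split; last first.
  apply: (@le_lt_trans _ _ (l2vec b)%:E); last exact: ltry.
  apply: opnorm_leP => [|h]; first exact: l2_ge0.
  by rewrite rnorm_col_op ler_wpM2l ?l2_ge0 // rnorm_None_le.
move=> a f g; apply/ffunP => -[j|]; rewrite !ffunE /=.
  by rewrite scalerDr !scalerA mulrC.
by rewrite scaler0 addr0.
Qed.

Lemma col_op_contr (N : V -> \bar R) :
  (forall b, ((l2vec b)%:E <= N b)%E) ->
  (lin_norm N (col_op : {linear V -> (K -> K)}) <= 1)%E.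
Proof.
move=> leN; apply: ge_ereal_sup => _ [b /= b1 <-].
apply: opnorm_leP => // h; rewrite rnorm_col_op mul1r.
have := le_trans (leN b) b1; rewrite lee_fin => b1'.
by rewrite -[leRHS]mul1r ler_pM ?l2_ge0 ?rnorm_ge0 // rnorm_None_le.
Qed.

End ColumnMap.

Section Column.
Variables (R : realType).

(** x as an operator from H^p to (H^J)^n, each entry being read as a column. *)
Definition colapp (H : hilbertSpace R) (J : finType) n p
    (x : 'M[{ffun J -> R[i]}]_(n, p)) (h : 'I_p -> H) (k : J * 'I_n) : H :=
  \sum_(j < p) x k.2 j k.1 *: h j.

Lemma hnorm_colapp (H : hilbertSpace R) (J : finType) n p
    (x : 'M[{ffun J -> R[i]}]_(n, p)) (h : 'I_p -> H) :
  hnorm (colapp x h) =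
  l2 (index_enum J) (fun j => hnorm (fun i => colapp x h (j, i))).
Proof.
rewrite /l2; congr Num.sqrt; under [RHS]eq_bigr do rewrite sqr_l2.
by rewrite pair_bigA /=; apply: eq_bigr => -[].
Qed.

(** The identity from E to the column Hilbert space C^J is completely
    contractive. *)
Definition col_contractive (J : finType) (E : mxnorms {ffun J -> R[i]}) : Prop :=
  forall (H : hilbertSpace R) n p (x : 'M[{ffun J -> R[i]}]_(n, p)) (h : 'I_p -> H),
    ((hnorm (colapp x h))%:E <= E n p x * (hnorm h)%:E)%E.

(** [col_op] embeds C^J isometrically into some B(K), so it is one of the
    contractions over which the maximal norm is a supremum. *)
Lemma max_os_col (J : finType) (N : {ffun J -> R[i]} -> \bar R) :
  (forall b, ((l2vec b)%:E <= N b)%E) -> col_contractive (max_os N).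
Proof.
move=> leN H n p x h.
pose K := hsum_hilbert H (option J).
pose g (j : 'I_p) : hsum H (option J) := [ffun o => if o is Some _ then 0 else h j].
have gh : hnorm (g : 'I_p -> K) = hnorm h.
  congr Num.sqrt; apply: eq_bigr => j _; congr (_ ^+ 2).
  rewrite rnorm_option big1 => [|i _]; last by rewrite ffunE rnorm0 expr0n.
  by rewrite ffunE addr0 sqrtr_sqr ger0_norm ?rnorm_ge0.
rewrite -gh; pose u : {linear {ffun J -> R[i]} -> (K -> K)} := @col_op R H J.
have -> : hnorm (colapp x h) = hnorm (mxapp (map_mx u x) g).
  congr Num.sqrt.
  rewrite -(pair_bigA _ (fun j i => rnorm (colapp x h (j, i)) ^+ 2)) exchange_big /=.
  apply: eq_bigr => i _.
  have coordE o : ((mxapp (map_mx u x) g i : hsum H (option J)) o) =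
      if o is Some j then colapp x h (j, i) else 0.
    rewrite /mxapp sum_ffunE; case: o => [j|].
      by apply: eq_bigr => k _; rewrite mxE !ffunE.
    by rewrite big1 // => k _; rewrite mxE !ffunE.
  rewrite (rnorm_option (mxapp (map_mx u x) g i)) sqr_sqrtr; last first.
    by rewrite addr_ge0 ?sqr_ge0 ?sum_sqr_ge0.
  rewrite coordE rnorm0 expr0n add0r.
  by apply: eq_bigr => j _; rewrite coordE.
apply: le_trans (opnorm_mx_le _ _) _.
  by move=> i j; rewrite mxE; have [] := col_op_bounded H (x i j).
apply: lee_wpmul2r; first by rewrite lee_fin hnorm_ge0.
by apply: max_os_ge; [exact: col_op_bounded | exact: col_op_contr].
Qed.

(** When A is infinite the hypothesis still forces f to vanish where t does. *)
Lemma l2_emul (J : finType) (A : \bar R) (f t : J -> R) :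
  (0 <= A)%E -> (forall j, 0 <= f j) ->
  (forall j, ((f j)%:E <= A * (t j)%:E)%E) ->
  ((l2 (index_enum J) f)%:E <= A * (l2 (index_enum J) t)%:E)%E.
Proof.
case: A => [a|_ f0 le_ft|] //.
  rewrite lee_fin => a0 f0 le_ft; rewrite -EFinM lee_fin -l2Z //.
  by apply: l2_le => j; rewrite f0 -lee_fin EFinM le_ft.
have [t0|tN0] := eqVneq (l2 (index_enum J) t) 0; last first.
  by rewrite gt0_mulye ?leey // lte_fin lt_def tN0 l2_ge0.
have t0j j : t j = 0.
  apply/eqP; rewrite -sqrf_eq0 eq_le sqr_ge0 andbT.
  move/eqP: t0; rewrite sqrtr_eq0; apply: le_trans.
  by rewrite (bigD1 j) //= lerDl sum_sqr_ge0.
rewrite t0 mule0 lee_fin /l2 big1 ?sqrtr0 // => j _.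
have := le_ft j; rewrite t0j mule0 lee_fin => fj.
by rewrite (_ : f j = 0) ?expr0n //; apply/eqP; rewrite eq_le fj f0.
Qed.

Lemma ereal_inf_mul (S : set (\bar R)) (c t : R) : 0 < t ->
  (forall r, S r -> (c%:E <= r * t%:E)%E) -> (c%:E <= ereal_inf S * t%:E)%E.
Proof.
move=> t0 le_c; rewrite -lee_pdivrMr //.
by apply: le_ereal_inf_tmp => r Sr; rewrite lee_pdivrMr //; exact: le_c.
Qed.

Variables (I J : finType) (E : mxnorms {ffun I -> R[i]}) (F : mxnorms {ffun J -> R[i]}).
Hypothesis E_ge0 : forall n p (x : 'M[_]_(n, p)), (0 <= E x)%E.
Hypothesis F_ge0 : forall n p (x : 'M[_]_(n, p)), (0 <= F x)%E.

Lemma haagerup_ge0 n p (x : 'M[_]_(n, p)) : (0 <= haagerup E F x)%E.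
Proof. by apply: le_ereal_inf_tmp => _ [q [a [b [_ ->]]]]; rewrite mule_ge0. Qed.

Hypothesis F_col : col_contractive F.

(** For x = a . b, applying x to h amounts to applying the column b first, which
    gives one vector y_j for each j, and the column a to each y_j afterwards:
    C^I (x)_h C^J is C^(I * J). *)
Lemma haagerup_col : col_contractive E -> col_contractive (haagerup E F).
Proof.
move=> E_col H n p x h.
have [h0|hN0] := eqVneq (hnorm h) 0.
  rewrite h0 mule0 lee_fin hnorm0 // => k; rewrite /colapp big1 // => j _.
  by rewrite (hnorm_eq0 h0) scaler0.
apply: ereal_inf_mul; first by rewrite lt_def hN0 hnorm_ge0.
move=> _ [q [a [b [xE ->]]]].
pose y j (l : 'I_q) := colapp b h (j, l).
have -> : hnorm (colapp x h) =
    l2 (index_enum J) (fun j => hnorm (colapp a (y j))).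
  rewrite /l2; congr Num.sqrt.
  under [RHS]eq_bigr do rewrite sqr_l2.
  rewrite pair_bigA /=.
  rewrite (reindex (fun k : J * (I * 'I_n) => ((k.2.1, k.1), k.2.2))) /=; last first.
    by exists (fun k : (I * J) * 'I_n => (k.1.2, (k.1.1, k.2))) => [[j [i k]]|[[i j] k]].
  apply: eq_bigr => -[j [i k]] _ /=; congr (rnorm _ ^+ 2); rewrite /colapp /y /colapp /=.
  under eq_bigr do rewrite xE sum_ffunE scaler_suml.
  rewrite exchange_big /=; apply: eq_bigr => l _.
  by rewrite scaler_sumr; apply: eq_bigr => o _; rewrite ffunE scalerA.
apply: le_trans (_ : _ <= E a * (l2 (index_enum J) (fun j => hnorm (y j)))%:E)%E _.
  by apply: l2_emul => // j; exact: hnorm_ge0.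
rewrite -muleA; apply: lee_wpmul2l => //.
by rewrite -[X in (X%:E <= _)%E]hnorm_colapp; exact: F_col.
Qed.

End Column.

(** * The upper estimate *)
Section Upper.
Variable R : realType.

(** The identity from E to max(E) has cb norm at most c, in a form which makes
    sense for rectangular matrices and needs no finiteness. *)
Definition extension_bound (J : finType) (c : R) (E : mxnorms {ffun J -> R[i]}) : Prop :=
  forall (H : hilbertSpace R) (u : {linear {ffun J -> R[i]} -> (H -> H)}),
    (forall b, bounded_op (u b)) -> (lin_norm (base_norm E) u <= 1)%E ->
    forall n p (x : 'M[{ffun J -> R[i]}]_(n, p)) (h : 'I_p -> H),
    ((hnorm (mxapp (map_mx u x) h))%:E <= c%:E * E n p x * (hnorm h)%:E)%E.

Lemma base_max_os_le1 (V : lmodType R[i]) (N : V -> \bar R) (b : V) :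
  (N b <= 1)%E -> (base_norm (max_os N) b <= 1)%E.
Proof.
move=> b1; apply: max_os_le => // H u h ub u1; rewrite mul1r.
apply: l2_le => i; rewrite rnorm_ge0 /mxapp big_ord_recl big_ord0 addr0 !mxE.
by rewrite (ord1 i); apply: (lin_norm_contr _ (ub b) u1).
Qed.

Lemma max_os_extension (J : finType) (N : {ffun J -> R[i]} -> \bar R) :
  extension_bound 1 (max_os N).
Proof.
move=> H u ub u1 n p x h; rewrite mul1e.
apply: le_trans (opnorm_mx_le _ _) _.
  by move=> i j; rewrite mxE; have [] := ub (x i j).
apply: lee_wpmul2r; first by rewrite lee_fin hnorm_ge0.
apply: max_os_ge => //; apply: le_trans u1.
apply: ge_ereal_sup => _ [b /= b1 <-]; apply: ereal_sup_ubound.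
by exists b => //; exact: base_max_os_le1.
Qed.

Lemma sum_emul (J : finType) (A : \bar R) (f t : J -> R) :
  (forall j, 0 <= t j) -> (forall j, ((f j)%:E <= A * (t j)%:E)%E) ->
  ((\sum_j f j)%:E <= A * (\sum_j t j)%:E)%E.
Proof.
move=> t0 le_ft; rewrite -!sumEFin ge0_sume_distrr => [|j _].
  exact: lee_sum.
by rewrite lee_fin.
Qed.

Section TensBasis.
Variables (J I : finType) (j : J).

(** A function of v alone, so that v |-> v (x) e_j can carry a linear structure
    and be composed with linear maps. *)
Definition tens_basis (v : {ffun I -> R[i]}) : {ffun I * J -> R[i]} :=
  tens v (basis_vec R j).

Lemma tens_basis_linear : linear tens_basis.
Proof. by move=> a v v'; apply/ffunP => k; rewrite !ffunE mulrDl -mulrA. Qed.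
HB.instance Definition _ :=
  GRing.isLinear.Build _ _ _ _ tens_basis tens_basis_linear.

End TensBasis.

Lemma tens_basis_expand (I J : finType) (v : {ffun I -> R[i]}) (w : {ffun J -> R[i]}) :
  tens v w = \sum_j w j *: tens v (basis_vec R j).
Proof.
apply/ffunP => -[i j]; rewrite sum_ffunE (bigD1 j) //= big1 => [|j' j'j].
  by rewrite !ffunE eqxx mulr1 addr0 [RHS]mulrC.
by rewrite !ffunE /= (negbTE j'j) mulr0 scaler0.
Qed.

Lemma sum_le_sqrt_card_l2 (J : finType) (t : J -> R) :
  \sum_j t j <= Num.sqrt #|J|%:R * l2 (index_enum J) t.
Proof.
have -> : Num.sqrt #|J|%:R = l2 (index_enum J) (fun=> 1 : R).
  rewrite /l2; congr (Num.sqrt _); rewrite -sum1_card natr_sum.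
  by apply: eq_bigr => j _; rewrite expr1n.
apply: le_trans (sum_mul_le_l2 _ _ _).
by apply: ler_sum => j _; rewrite mul1r.
Qed.

Variables (I J : finType) (E : mxnorms {ffun I -> R[i]}) (F : mxnorms {ffun J -> R[i]}).
Hypothesis E_ge0 : forall n p (x : 'M[_]_(n, p)), (0 <= E x)%E.
Hypothesis F_ge0 : forall n p (x : 'M[_]_(n, p)), (0 <= F x)%E.
Hypothesis F_col : col_contractive F.
Hypothesis F_basis : forall j, (base_norm F (basis_vec R j) <= 1)%E.

Lemma haagerup_base_tens (v : {ffun I -> R[i]}) (j : J) :
  (base_norm E v <= 1)%E ->
  (base_norm (haagerup E F) (tens v (basis_vec R j)) <= 1)%E.
Proof.
move=> v1; apply: (@le_trans _ _ (base_norm E v * base_norm F (basis_vec R j))%E).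
  apply: ereal_inf_lbound; exists 1%N, (const_mx v), (const_mx (basis_vec R j)).
  by split=> // i k; rewrite big_ord_recl big_ord0 addr0 !mxE.
rewrite -[leRHS]mule1; apply: lee_pmul => //; rewrite /base_norm.
  exact: E_ge0.
exact: F_ge0.
Qed.

(** For x = a . b and b = sum_j b_j e_j one has u(x) = sum_j u_j(a) b_j, where
    u_j = u(. (x) e_j) is a contraction on E because e_j has norm at most 1.  The
    triangle inequality and Cauchy-Schwarz over j turn the l_1 sum of the
    |b_j h| into sqrt #|J| times the norm of the column b applied to h. *)
Lemma haagerup_extension (c : R) : 0 < c -> (0 < #|J|)%N ->
  extension_bound c E ->
  extension_bound (c * Num.sqrt #|J|%:R) (haagerup E F).
Proof.
move=> c0 J0 E_ext H u ub u1 n p x h.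
have [h0|hN0] := eqVneq (hnorm h) 0.
  rewrite h0 mule0 lee_fin hnorm0 // => k; rewrite /mxapp big1 // => j _.
  by rewrite (hnorm_eq0 h0) mxE lin0 //; have [] := ub (x k j).
have hp : 0 < hnorm h by rewrite lt_def hN0 hnorm_ge0.
have s0 : 0 < Num.sqrt #|J|%:R :> R by rewrite sqrtr_gt0 ltr0n.
rewrite [X in (X * _)%E]muleC -muleA -EFinM.
apply: ereal_inf_mul; first by rewrite !mulr_gt0.
move=> _ [q [a [b [xE ->]]]].
pose T := @tens_basis J I : J -> {linear {ffun I -> R[i]} -> {ffun I * J -> R[i]}}.
pose uT j : {linear {ffun I -> R[i]} -> (H -> H)} := u \o T j.
have uT_contr j : (lin_norm (base_norm E) (uT j) <= 1)%E.
  apply: le_trans u1; apply: ge_ereal_sup => _ [v /= v1 <-].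
  apply: ereal_sup_ubound; exists (tens v (basis_vec R j)) => //.
  exact: haagerup_base_tens.
pose y j (l : 'I_q) := colapp b h (j, l).
pose z j := mxapp (map_mx (uT j) a) (y j).
have le_z : hnorm (mxapp (map_mx u x) h) <= \sum_j hnorm (z j).
  apply: le_trans (l2_sum _ _ _); apply: l2_le => i; rewrite rnorm_ge0 /=.
  suff -> : mxapp (map_mx u x) h i = \sum_j z j i by exact: rnorm_sum.
  rewrite /z /mxapp exchange_big /=.
  transitivity (\sum_(k < p) \sum_(l < q) \sum_j u (T j (a i l)) (b l k j *: h k)).
    apply: eq_bigr => k _; rewrite mxE xE raddf_sum /= fct_sumE.
    apply: eq_bigr => l _; rewrite tens_basis_expand raddf_sum /= fct_sumE.
    apply: eq_bigr => j _; rewrite linearZ /= linZ //.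
    by have [] := ub (tens (a i l) (basis_vec R j)).
  rewrite exchange_big /=; apply: eq_bigr => l _.
  rewrite exchange_big /=; apply: eq_bigr => j _.
  by rewrite mxE /y /colapp /= lin_sum //; have [] := ub (T j (a i l)).
have le_sum_z : ((\sum_j hnorm (z j))%:E <=
    c%:E * E a * (\sum_j hnorm (y j))%:E)%E.
  apply: sum_emul => j; first exact: hnorm_ge0.
  by apply: E_ext => // v; exact: ub.
apply: le_trans (_ : _ <= (\sum_j hnorm (z j))%:E)%E _; first by rewrite lee_fin.
apply: le_trans le_sum_z _.
apply: le_trans (_ : _ <= c%:E * E a * ((Num.sqrt #|J|%:R)%:E * (F b * (hnorm h)%:E)))%E _.
  apply: lee_wpmul2l; first by rewrite mule_ge0 // lee_fin ltW.
  apply: (@le_trans _ _ (Num.sqrt #|J|%:R * l2 (index_enum J) (fun j => hnorm (y j)))%:E).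
    by rewrite lee_fin sum_le_sqrt_card_l2.
  rewrite EFinM; apply: lee_wpmul2l; first by rewrite lee_fin ltW.
  by rewrite -[X in (X%:E <= _)%E]hnorm_colapp; exact: F_col.
rewrite !EFinM.
have -> : (c%:E * E a * ((Num.sqrt #|J|%:R)%:E * (F b * (hnorm h)%:E)) =
  E a * F b * (c%:E * (Num.sqrt #|J|%:R)%:E * (hnorm h)%:E))%E.
  by rewrite muleACA [RHS]muleCA -[in RHS](muleA (E a)).
exact: lexx.
Qed.

End Upper.

(** A 1 x 1 matrix, read as a column and applied to the scalar 1. *)
Lemma l2_le_base (R : realType) (J : finType) (E : mxnorms {ffun J -> R[i]})
    (x : {ffun J -> R[i]}) :
  col_contractive E -> ((l2vec x)%:E <= base_norm E x)%E.
Proof.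
move=> E_col; pose h : 'I_1 -> scalar_hilbert R := fun=> (1 : R[i]).
have := E_col _ _ _ (const_mx x : 'M[_]_(1, 1)) h.
have -> : hnorm h = 1.
  by rewrite /hnorm /l2 big_ord_recl big_ord0 addr0 expr2 !rnorm1 mulr1 sqrtr1.
rewrite mule1; suff -> : hnorm (colapp (const_mx x : 'M[_]_(1, 1)) h) = l2vec x by [].
rewrite /l2vec /hnorm /l2 -(pair_bigA _ (fun j i => rnorm (colapp _ h (j, i)) ^+ 2)) /=.
congr Num.sqrt; apply: eq_bigr => j _.
rewrite big_ord_recl big_ord0 addr0 /colapp big_ord_recl big_ord0 addr0 mxE.
by rewrite rnormZ rnorm1 mulr1.
Qed.

Section Tower.
Variables (R : realType) (m : nat).
Local Notation J := 'I_m.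
Local Notation C := R[i].
Local Notation N1 := (fun x : {ffun J -> C} => (ell1_norm x)%:E).
Local Notation E k := (@haagerup_pow R J (max_os N1) k).

Lemma tower_ge0 k n p (x : 'M[{ffun tpow_idx J k -> C}]_(n, p)) :
  (0 <= E k x)%E.
Proof.
elim: k n p x => [|k IH] n p x; first exact: max_os_ge0.
by apply: haagerup_ge0 => *; [exact: IH | exact: max_os_ge0].
Qed.

Lemma ell1_col : col_contractive (max_os N1).
Proof.
apply: max_os_col => b; rewrite lee_fin; apply: l2_le_sum => j.
exact: rnorm_ge0.
Qed.

Lemma tower_col k : col_contractive (E k).
Proof.
elim: k => [|k IH]; first exact: ell1_col.
apply: haagerup_col => //; last exact: ell1_col.
by move=> *; exact: tower_ge0.
Qed.

Lemma ell1_basis (j : J) : (base_norm (max_os N1) (basis_vec R j) <= 1)%E.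
Proof.
apply: base_max_os_le1; rewrite lee_fin /ell1_norm (bigD1 j) //= big1 => [|i ij].
  by rewrite ffunE eqxx rnorm1 addr0.
by rewrite ffunE eq_sym (negbTE ij) rnorm0.
Qed.

Lemma tower_extension k : (0 < m)%N ->
  extension_bound (Num.sqrt m%:R ^+ k) (E k).
Proof.
move=> m0; elim: k => [|k IH]; first exact: max_os_extension.
rewrite exprSr -[X in X%:R]card_ord; apply: haagerup_extension => //.
- by move=> *; exact: tower_ge0.
- by move=> *; exact: max_os_ge0.
- exact: ell1_col.
- exact: ell1_basis.
- by rewrite exprn_gt0 // sqrtr_gt0 card_ord ltr0n.
- by rewrite card_ord.
- by rewrite card_ord.
Qed.

(** The canonical tensor basis is orthonormal in the Hilbert tensor product. *)
Lemma tens_dot_powE k (x y : {ffun tpow_idx J k -> C}) :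
  tens_dot_pow (@ell2_dot R m) x y = \sum_i x i * Num.conj (y i).
Proof.
elim: k x y => [//|k IH] x y /=; rewrite /tens_dot.
have dotB k' (a b : tpow_idx J k') :
    \sum_i basis_vec R a i * Num.conj (basis_vec R b i) = (a == b)%:R.
  rewrite (bigD1 a) //= big1 => [|i ia].
    by rewrite !ffunE eqxx mul1r addr0 conjC_nat eq_sym.
  by rewrite !ffunE eq_sym (negbTE ia) mul0r.
apply: eq_bigr => -[a b] _; rewrite (bigD1 (a, b)) //= big1 => [|[a' b'] ne].
  by rewrite IH dotB /ell2_dot (dotB 0%N) !eqxx !mulr1 addr0.
rewrite IH dotB /ell2_dot (dotB 0%N) /=.
case: (eqVneq a a') ne => [<-|]; last by rewrite mul0r mulr0.
case: (eqVneq b b') => [<-|]; last by rewrite !mulr0.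
by rewrite eqxx.
Qed.

Lemma dot_norm_l2 k (x : {ffun tpow_idx J k -> C}) :
  dot_norm (tens_dot_pow (k := k) (@ell2_dot R m)) x = l2vec x.
Proof.
rewrite /dot_norm tens_dot_powE /l2vec /l2; congr Num.sqrt.
rewrite (eq_bigr (fun i => (rnorm (x i) ^+ 2)%:C%C)) => [|i _].
  by rewrite -rmorph_sum.
exact: conj_mul.
Qed.

Lemma l2_le_tower k (x : {ffun tpow_idx J k -> C}) :
  ((l2vec x)%:E <= base_norm (E k) x)%E.
Proof. exact: (l2_le_base x (@tower_col k)). Qed.

End Tower.

Section CbUpper.
Variables (R : realType) (J : finType) (E : mxnorms {ffun J -> R[i]}).
Implicit Types N : {ffun J -> R[i]} -> \bar R.

Lemma cbnorm_max_le (c : R) : 0 <= c ->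
  (forall n p (x : 'M[_]_(n, p)), (0 <= E x)%E) -> extension_bound c E ->
  (cbnorm E (max_os (base_norm E)) idfun <= c%:E)%E.
Proof.
move=> c0 E0 E_ext; apply: ge_ereal_sup => _ [n [x [x1 ->]]].
apply: max_os_le => // H u h ub u1; rewrite -lee_fin.
have -> : map_mx u (map_mx idfun x) = map_mx u x by apply/matrixP => i j; rewrite !mxE.
apply: le_trans (E_ext _ _ ub u1 _ _ _ _) _; rewrite EFinM.
apply: lee_wpmul2r; first by rewrite lee_fin hnorm_ge0.
by rewrite -[leRHS]mule1; apply: lee_wpmul2l.
Qed.

(** A larger norm N has more contractive maps, hence a larger maximal
    structure. *)
Lemma cbnorm_max_mono N N' : (forall b, (N b <= N' b)%E) ->
  (cbnorm E (max_os N) idfun <= cbnorm E (max_os N') idfun)%E.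
Proof.
move=> leN; apply: ge_ereal_sup => _ [n [x [x1 ->]]].
apply: le_trans (_ : _ <= max_os N' (map_mx idfun x))%E _; last first.
  by apply: ereal_sup_ubound; exists n, x.
apply: ge_ereal_sup => _ [H [u [ub u1 ->]]]; apply: max_os_ge => //.
apply: le_trans u1; apply: ge_ereal_sup => _ [b /= b1 <-].
by apply: ereal_sup_ubound; exists b => //; exact: le_trans (leN b) b1.
Qed.

End CbUpper.

(** * Reduced words in a free product of groups of order two *)
Section Words.
Variable A : finType.
Implicit Types (k : A) (u v w : seq A).

(** Left multiplication by a generator in the free product of copies of Z/2, one
    for each element of A, whose elements are the reduced words. *)
Definition lact k w := if w is k' :: w' then if k == k' then w' else k :: w else [:: k].
Definition wact u w := foldr lact w u.
Definition reduced w := sorted (fun x y => x != y) w.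

Lemma reduced_tail k w : reduced (k :: w) -> reduced w.
Proof. by case: w => //= a w /andP[]. Qed.

Lemma lact_reduced k w : reduced w -> reduced (lact k w).
Proof.
case: w => //= k' w; case: eqVneq => [_|kk' red]; last by rewrite /= kk'.
exact: reduced_tail.
Qed.

Lemma wact_reduced u w : reduced w -> reduced (wact u w).
Proof. by move=> red; elim: u => //= k u IH; exact: lact_reduced. Qed.

Lemma lactK k w : reduced w -> lact k (lact k w) = w.
Proof.
case: w => [|k' w] /=; first by rewrite eqxx.
case: eqVneq => [<-|kk' _]; last by rewrite /= eqxx.
by case: w => //= k'' w /andP[/negbTE ->].
Qed.

Lemma wactK u w : reduced w -> wact (rev u) (wact u w) = w.
Proof.
move=> red; elim: u => //= k u IH.
by rewrite rev_cons -cats1 /wact foldr_cat /= lactK ?wact_reduced.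
Qed.

Lemma wact_nil u : reduced u -> wact u [::] = u.
Proof.
elim: u => //= k u IH red; rewrite IH; last exact: reduced_tail red.
by case: u red {IH} => //= k' u /andP[/negbTE ->].
Qed.

Lemma size_lact k w : (size (lact k w) <= (size w).+1)%N.
Proof. by case: w => //= k' w; case: ifP => //= _; lia. Qed.

Lemma size_wact u w : (size (wact u w) <= size u + size w)%N.
Proof. by elim: u => //= k u IH; apply: leq_trans (size_lact _ _) _. Qed.

(** In the product of a reduced word u with w, the last letters of u cancel
    against the first letters of w until two of them differ; from then on
    nothing cancels, because u is reduced. *)
Lemma wact_cancel u w : reduced u ->
  exists p q w', [/\ u = p ++ q, w = rev q ++ w' & wact u w = p ++ w'].
Proof.
elim: u => [|k u IH] red; first by exists [::], [::], w.
have [p [q [w' [uE wE actE]]]] := IH (reduced_tail red).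
rewrite /= actE; case: p uE {actE} => [|k' p] uE.
  case: w' wE => [|k' w'] wE /=; first by exists [:: k], q, [::]; rewrite uE.
  case: eqVneq => [kk'|_]; last by exists [:: k], q, (k' :: w'); rewrite uE.
  by exists [::], (k :: q), w'; rewrite uE wE rev_cons cat_rcons kk'.
exists (k :: k' :: p), q, w'; rewrite uE; split=> //=.
by move: red; rewrite uE /= => /andP[/negbTE ->].
Qed.

Definition words n : seq (seq A) := [seq val t | t <- enum {: n.-tuple A}].
Definition words_le n : seq (seq A) := [seq val t | t <- enum {: n.-bseq A}].

Lemma mem_words n w : (w \in words n) = (size w == n).
Proof.
apply/mapP/idP => [[t _ ->]|/eqP sw]; first by rewrite size_tuple.
by subst n; exists (in_tuple w); rewrite ?mem_enum.
Qed.

Lemma mem_words_le n w : (w \in words_le n) = (size w <= n)%N.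
Proof.
apply/mapP/idP => [[t _ ->]|sw]; first exact: size_bseq.
by exists (Bseq sw); rewrite ?mem_enum.
Qed.

Lemma uniq_words n : uniq (words n).
Proof. by rewrite map_inj_uniq ?enum_uniq //; exact: val_inj. Qed.

Lemma uniq_words_le n : uniq (words_le n).
Proof. by rewrite map_inj_uniq ?enum_uniq //; exact: val_inj. Qed.

End Words.

(** * Haagerup's inequality on the tree of reduced words *)
Section SumInj.
Variable R : rcfType.

Lemma ler_sum_subset (T : eqType) (s1 s2 : seq T) (F : T -> R) :
  uniq s1 -> {subset s1 <= s2} -> (forall x, 0 <= F x) ->
  \sum_(x <- s1) F x <= \sum_(x <- s2) F x.
Proof.
move=> + + F0; elim: s1 s2 => [|x s1 IH] s2 /=.
  by move=> _ _; rewrite big_nil sumr_ge0.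
move=> /andP[xs1 us1] sub; rewrite big_cons.
have xs2 : x \in s2 by apply: sub; rewrite mem_head.
rewrite (perm_big _ (perm_to_rem xs2)) big_cons lerD2l; apply: IH => // y ys1.
have : y \in s2 by apply: sub; rewrite inE ys1 orbT.
rewrite (perm_mem (perm_to_rem xs2)) inE => /orP[/eqP yx|//].
by rewrite -yx ys1 in xs1.
Qed.

Lemma ler_sum_inj (T1 T2 : eqType) (s1 : seq T1) (s2 : seq T2) (P : pred T1)
    (phi : T1 -> T2) (F : T2 -> R) :
  uniq s1 -> (forall y, 0 <= F y) ->
  (forall x, x \in s1 -> P x -> phi x \in s2) ->
  {in [seq x <- s1 | P x] &, injective phi} ->
  \sum_(x <- s1 | P x) F (phi x) <= \sum_(y <- s2) F y.
Proof.
move=> us1 F0 phis2 phi_inj; rewrite -big_filter -(big_map phi xpredT).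
apply: ler_sum_subset => //; first by rewrite map_inj_in_uniq // filter_uniq.
move=> y /mapP[x]; rewrite mem_filter => /andP[Px xs1] ->; exact: phis2.
Qed.

End SumInj.

Section HaagerupInequality.
Variables (R : rcfType) (A : finType) (d r L : nat).
Variables (al f g : seq A -> R).
Hypotheses (al0 : forall u, 0 <= al u) (f0 : forall u, 0 <= f u).
Hypotheses (g0 : forall u, 0 <= g u) (dL : (r + d <= L)%N).

Let F (z : (seq A * seq A) * seq A) : R :=
  al (z.1.1 ++ z.1.2) * (f (rev z.1.2 ++ z.2) * g (z.1.1 ++ z.2)).

Let F0 z : 0 <= F z.
Proof. by rewrite /F !mulr_ge0. Qed.

(** The terms in which exactly c letters cancel: for u = p ++ q with q of length
    c and v = rev q ++ w, the product is p ++ w.  For fixed w the sum over p and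
    q is the pairing of the matrix al(p ++ q) with the rank one matrix
    f(rev q ++ w) g(p ++ w), bounded by its Hilbert-Schmidt norm; Cauchy-Schwarz
    over w finishes, since a word determines its prefix of a given length and
    the rest. *)
Lemma cancelled_sum_le c : (c <= d)%N ->
  \sum_(w <- words_le A r) \sum_(z <- [seq (p, q) | p <- words A (d - c), q <- words A c])
    F (z, w) <=
  l2 (words A d) al * (l2 (words_le A L) f * l2 (words_le A L) g).
Proof.
move=> cd; set Z := [seq (p, q) | p <- _, q <- _].
have le_al : l2 Z (fun z => al (z.1 ++ z.2)) <= l2 (words A d) al.
  rewrite ler_wsqrtr //.
  apply: (@ler_sum_inj _ _ _ _ _ xpredT (fun z => z.1 ++ z.2) (fun u => al u ^+ 2)).
  - by rewrite allpairs_uniq ?uniq_words // => -[? ?] [? ?].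
  - by move=> u; rewrite sqr_ge0.
  - move=> z /allpairsP[[p q] [/= + + ->]] _ /=.
    by rewrite !mem_words size_cat => /eqP -> /eqP ->; apply/eqP; lia.
  move=> z z'; rewrite !filter_predT => /allpairsP[[p q] [/= + + ->]].
  move=> + + /allpairsP[[p' q'] [/= + + ->]] /=; rewrite !mem_words.
  move=> /eqP sp /eqP sq /eqP sp' /eqP sq' /eqP.
  by rewrite eqseq_cat ?sp ?sp' // => /andP[/eqP -> /eqP ->].
pose fw w := l2 (words A c) (fun q => f (rev q ++ w)).
pose gw w := l2 (words A (d - c)) (fun p => g (p ++ w)).
apply: (@le_trans _ _ (\sum_(w <- words_le A r) l2 (words A d) al * (fw w * gw w))).
  apply: ler_sum => w _; apply: le_trans (sum_mul_le_l2 _ _ _) _.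
  rewrite ler_pM ?l2_ge0 // /fw /gw /l2 -sqrtrM ?sum_sqr_ge0 // ler_wsqrtr //.
  rewrite big_allpairs /= exchange_big /= big_distrl /=; apply: ler_sum => q _.
  by rewrite big_distrr /=; apply: ler_sum => p _; rewrite exprMn.
rewrite -mulr_sumr ler_wpM2l ?l2_ge0 //.
apply: le_trans (sum_mul_le_l2 _ _ _) _.
have glue (h : seq A -> R) (n : nat) (s : seq A -> seq A) :
    injective s -> (forall q, size (s q) = size q) -> (n <= d)%N ->
    l2 (words_le A r) (fun w => l2 (words A n) (fun q => h (s q ++ w))) <=
    l2 (words_le A L) h.
  move=> s_inj s_size nd; rewrite ler_wsqrtr //.
  under eq_bigr do rewrite sqr_l2.
  rewrite -(big_allpairs (F := fun z => h (s z.2 ++ z.1) ^+ 2)).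
  apply: (@ler_sum_inj _ _ _ _ _ xpredT (fun z => s z.2 ++ z.1) (fun u => h u ^+ 2)).
  - by rewrite allpairs_uniq ?uniq_words ?uniq_words_le // => -[? ?] [? ?].
  - by move=> u; rewrite sqr_ge0.
  - move=> z /allpairsP[[w q] [/= + + ->]] _ /=.
    by rewrite mem_words !mem_words_le size_cat s_size => + /eqP ->; lia.
  move=> z z'; rewrite !filter_predT => /allpairsP[[w q] [/= + + ->]].
  move=> + + /allpairsP[[w' q'] [/= + + ->]] /=; rewrite !mem_words.
  move=> _ /eqP sq _ /eqP sq' /eqP.
  by rewrite eqseq_cat ?s_size ?sq ?sq' // => /andP[/eqP /s_inj -> /eqP ->].
apply: ler_pM; rewrite ?l2_ge0 //.
  by apply: (glue f c rev) => //; [exact: (can_inj revK) | exact: size_rev].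
by apply: (glue g (d - c)%N id) => //; rewrite leq_subr.
Qed.

(** Sort the pairs (u, w) by the number of cancelled letters, between 0 and d.
    The sum over all pairs with [P c], that is, with at least c matching
    letters, is a harmless overestimate as all the terms are nonnegative. *)
Lemma haagerup_inequality :
  \sum_(u <- words A d | reduced u) \sum_(w <- words_le A r) al u * f w * g (wact u w)
  <= d.+1%:R * (l2 (words A d) al * (l2 (words_le A L) f * l2 (words_le A L) g)).
Proof.
pose P c (x : seq A * seq A) := take c x.2 == rev (drop (d - c) x.1).
pose phi c (x : seq A * seq A) := ((take (d - c) x.1, drop (d - c) x.1), drop c x.2).
pose S := [seq (u, w) | u <- words A d, w <- words_le A r].
apply: (@le_trans _ _ (\sum_(c < d.+1) \sum_(x <- S | P c x) F (phi c x))).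
  under [leRHS]eq_bigr do rewrite big_mkcond.
  rewrite [leRHS]exchange_big /= /S big_allpairs /= big_mkcond /=.
  rewrite big_seq [leRHS]big_seq.
  apply: ler_sum => u; rewrite mem_words => /eqP su.
  case: ifPn => [red|_]; last first.
    by rewrite sumr_ge0 // => w _; rewrite sumr_ge0 // => c _; case: ifP.
  apply: ler_sum => w _.
  have [p [q [w' [uE wE ->]]]] := wact_cancel w red.
  have sq : (size q < d.+1)%N by move: su; rewrite uE size_cat; lia.
  rewrite (bigD1 (Ordinal sq)) //= ifT; last first.
    rewrite /P /=.
    have -> : (d - size q = size p)%N by move: su; rewrite uE size_cat; lia.
    by rewrite uE wE take_size_cat ?size_rev // drop_size_cat.
  rewrite /F /phi /= cat_take_drop.
  have -> : (d - size q = size p)%N by move: su; rewrite uE size_cat; lia.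
  rewrite uE wE take_size_cat // !drop_size_cat ?size_rev // mulrA lerDl.
  by apply: sumr_ge0 => c _; case: ifP => // _; rewrite !mulr_ge0.
apply: (@le_trans _ _ (\sum_(c < d.+1)
    l2 (words A d) al * (l2 (words_le A L) f * l2 (words_le A L) g))); last first.
  by rewrite sumr_const card_ord mulr_natl lexx.
apply: ler_sum => c _; apply: le_trans (cancelled_sum_le (leq_ord c)).
rewrite -(big_allpairs (F := fun y => F (y.2, y.1))).
apply: (@ler_sum_inj _ _ _ _ _ (P c) (fun x => let y := phi c x in (y.2, y.1))
  (fun y => F (y.2, y.1))) => //.
- by rewrite allpairs_uniq ?uniq_words ?uniq_words_le // => -[? ?] [? ?].
- move=> x /allpairsP[[u w] [/= + + ->]] _; rewrite mem_words mem_words_le => /eqP su sw.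
  apply/allpairsP; exists (drop c w, (take (d - c) u, drop (d - c) u)); split=> //=.
    by rewrite mem_words_le size_drop; lia.
  apply/allpairsP; exists (take (d - c) u, drop (d - c) u); split=> //=.
    by rewrite mem_words size_take su; case: ifP; lia.
  by rewrite mem_words size_drop su; have := leq_ord c; lia.
move=> x x'; rewrite !mem_filter => /andP[/eqP Px _] /andP[/eqP Px' _] [dw tu du].
case: x x' Px Px' dw tu du => [u w] [u' w'] /= Px Px' dw tu du.
have uu' : u = u' by rewrite -(cat_take_drop (d - c) u) tu du cat_take_drop.
congr (_, _) => //.
by rewrite -(cat_take_drop c w) Px uu' -Px' dw cat_take_drop.
Qed.

End HaagerupInequality.

(** * Permutations of large girth *)
Section Girth.
Variables (A : finType) (L : nat).

(** The ball of radius L of the Cayley tree.  A generator acts on it by left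
    multiplication wherever that stays in the ball, and fixes the other points;
    this is an involution. *)
Definition ball := {w : L.-bseq A | reduced w}.

Definition ball_word (x : ball) : seq A := val (val x).

Lemma ball_word_inj : injective ball_word.
Proof. by move=> x y /val_inj/val_inj. Qed.

Lemma ball_reduced (x : ball) : reduced (ball_word x).
Proof. exact: (valP x). Qed.

(** Total coercion of words to the ball; the point x is only a default. *)
Definition mkball (w : seq A) (x : ball) : ball :=
  if insub w is Some b then insubd x (b : L.-bseq A) else x.

Lemma mkballE (w : seq A) (x : ball) : (size w <= L)%N -> reduced w ->
  ball_word (mkball w x) = w.
Proof.
move=> sw red; rewrite /mkball insubT /=.
by rewrite /ball_word val_insubd /= red.
Qed.

Definition ball_act (k : A) (x : ball) : ball :=
  if (size (lact k (ball_word x)) <= L)%N then mkball (lact k (ball_word x)) x else x.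

Lemma ball_actE k x : (size (lact k (ball_word x)) <= L)%N ->
  ball_word (ball_act k x) = lact k (ball_word x).
Proof.
by move=> sz; rewrite /ball_act sz mkballE // lact_reduced // ball_reduced.
Qed.

Lemma ball_actK k : involutive (ball_act k).
Proof.
move=> x; have [sz|sz] := boolP (size (lact k (ball_word x)) <= L)%N; last first.
  by rewrite {2}/ball_act (negbTE sz) /ball_act (negbTE sz).
apply: ball_word_inj; rewrite ball_actE ?ball_actE // lactK ?ball_reduced //.
exact: (size_bseq (val x)).
Qed.

Definition ball_perm (k : A) : {perm ball} := perm (inv_inj (ball_actK k)).

Definition ball_nil : ball :=
  Sub [bseq] (erefl : reduced (val ([bseq] : L.-bseq A))).

Lemma ball_wact_nil (u : seq A) : (size u <= L)%N ->
  ball_word (foldr ball_act ball_nil u) = wact u [::].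
Proof.
elim: u => //= k u IH su; rewrite ball_actE IH ?(ltnW su) //.
apply: leq_trans su; apply: leq_trans (size_lact _ _) _.
by rewrite ltnS; have := size_wact u [::]; rewrite addn0.
Qed.

Lemma foldr_perm (u : seq A) (s : {perm ball}) (x : ball) :
  (foldr (fun k (s : {perm ball}) => s * ball_perm k)%g s u) x =
  foldr ball_act (s x) u.
Proof. by elim: u => //= k u IH; rewrite permM IH permE. Qed.

(** On the ball itself a nontrivial word may have fixed points near the boundary.
    The group of permutations of the ball acts freely on itself by
    multiplication, so a word with one fixed point in that action is the
    identity permutation of the ball; applied to the root of the tree it then
    gives the empty word. *)
Lemma large_girth :
  exists n (t : A -> 'I_n -> 'I_n),
    [/\ (0 < n)%N, forall k, involutive (t k)
      & forall u x, (size u <= L)%N -> foldr t x u = x -> wact u [::] = [::]].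
Proof.
pose G : finType := {perm ball}.
pose mul (k : A) (s : G) : G := (s * ball_perm k)%g.
exists #|G|, (fun k i => enum_rank (mul k (enum_val i))); split.
- by apply/card_gt0P; exists (1%g : {perm ball}).
- move=> k i; rewrite enum_rankK /mul -mulgA.
  suff -> : (ball_perm k * ball_perm k)%g = 1%g by rewrite mulg1 enum_valK.
  by apply/permP => x; rewrite permM perm1 !permE ball_actK.
move=> u i su.
have -> : foldr (fun k i => enum_rank (mul k (enum_val i))) i u =
    enum_rank (foldr mul (enum_val i) u).
  by elim: u {su} => [|k u /= ->]; rewrite ?enum_valK ?enum_rankK.
move=> /(congr1 enum_val); rewrite enum_rankK.
set s : {perm ball} := enum_val i => us.
have := congr1 (fun f : {perm ball} => f ((s^-1)%g ball_nil)) us.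
rewrite /= foldr_perm permKV => /(congr1 ball_word).
by rewrite ball_wact_nil.
Qed.

End Girth.

(** * Trimming a family of operators *)
Section Orthonormal.
Variables (R : realType) (H : hilbertSpace R).

Definition orthonormal_fam r (xi : 'I_r -> H) : Prop :=
  forall i j, hdot H (xi i) (xi j) = (i == j)%:R.

Definition proj_away r (xi : 'I_r -> H) (h : H) : H :=
  h - \sum_j hdot H h (xi j) *: xi j.

Section Proj.
Variables (r : nat) (xi : 'I_r -> H).
Hypothesis xi_orth : orthonormal_fam xi.

Lemma proj_away_orth h i : hdot H (proj_away xi h) (xi i) = 0.
Proof.
rewrite dotBl dot_suml (bigD1 i) //= dotZl xi_orth eqxx mulr1 big1 ?addr0 ?subrr //.
by move=> j ji; rewrite dotZl xi_orth (negbTE ji) mulr0.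
Qed.

Lemma proj_away_norm h :
  rnorm (proj_away xi h) ^+ 2 = rnorm h ^+ 2 - \sum_j rnorm (hdot H h (xi j)) ^+ 2.
Proof.
apply: (@complexI R); rewrite rmorphB rmorph_sum /= -!dotxx.
rewrite {2}/proj_away dotBr dot_sumr big1 => [|j _]; last first.
  by rewrite dotZr proj_away_orth mulr0.
rewrite subr0 dotBl dot_suml; congr (_ - _); apply: eq_bigr => j _.
by rewrite dotZl [hdot H (xi j) h]dotC conj_mul.
Qed.

Lemma Bessel h : \sum_j rnorm (hdot H h (xi j)) ^+ 2 <= rnorm h ^+ 2.
Proof. by rewrite -subr_ge0 -proj_away_norm sqr_ge0. Qed.

Lemma proj_away_le h : rnorm (proj_away xi h) <= rnorm h.
Proof.
rewrite -(@ler_pXn2r _ 2) ?nnegrE ?rnorm_ge0 // proj_away_norm.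
by rewrite lerBlDr lerDl sum_sqr_ge0.
Qed.

End Proj.

Lemma orthonormal_extend r (xi : 'I_r -> H) (h : H) :
  orthonormal_fam xi -> rnorm h = 1 -> (forall j, hdot H h (xi j) = 0) ->
  orthonormal_fam (fun j => oapp xi h (unlift ord_max j)).
Proof.
move=> xi_orth h1 h_orth i j.
case: (unliftP ord_max i) => [i' ->|->]; case: (unliftP ord_max j) => [j' ->|->] /=.
- by rewrite xi_orth (inj_eq lift_inj).
- by rewrite dotC h_orth conjC0 eq_sym (negbTE (neq_lift _ _)).
- by rewrite h_orth (negbTE (neq_lift _ _)).
- by rewrite dotxx h1 expr1n eqxx.
Qed.

End Orthonormal.

Section Trimming.
Variables (R : realType) (H : hilbertSpace R) (X : finType) (dl : X -> H).
Hypothesis parseval : forall h,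
  rnorm h ^+ 2 = \sum_x rnorm (hdot H h (dl x)) ^+ 2.
Variables (La : finType) (Y Z : La -> H -> H).
Hypothesis Y_linear : forall l, linear (Y l).
Hypothesis YZ : forall l x y, hdot H (Y l x) y = hdot H x (Z l y).

Let T l h := Z l (Y l h).

Lemma iter_selfadjoint l n x y :
  hdot H (iter n (T l) x) y = hdot H x (iter n (T l) y).
Proof.
have T_adj u v : hdot H (T l u) v = hdot H u (T l v).
  by rewrite /T dotC -YZ -dotC YZ.
by elim: n x y => //= n IH x y; rewrite T_adj IH -iterS iterSr.
Qed.

(** T = Y^* Y is positive, so its moments <T^n h, h> are log-convex in n.  Only
    doubling n is needed, and each doubling is one Cauchy-Schwarz. *)
Lemma power_mean l h s : rnorm h = 1 ->
  (rnorm (Y l h) ^+ 2) ^+ (2 ^ s) <= rnorm (iter (2 ^ s) (T l) h).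
Proof.
move=> h1; elim: s => [|s IH].
  rewrite expn0 expr1 /= -[leRHS]mulr1 -h1; apply: le_trans (Cauchy_Schwarz _ _).
  have -> : hdot H (T l h) h = (rnorm (Y l h) ^+ 2)%:C%C by rewrite dotC -YZ -dotC dotxx.
  by rewrite rnorm_real ler_norm.
rewrite expnSr exprM; apply: (@le_trans _ _ (rnorm (iter (2 ^ s) (T l) h) ^+ 2)).
  by rewrite lerXn2r // ?nnegrE ?rnorm_ge0 // !exprn_ge0 // rnorm_ge0.
rewrite muln2 -addnn iterD -[leRHS]mulr1 -h1.
apply: le_trans (Cauchy_Schwarz _ _).
by rewrite iter_selfadjoint dotxx rnorm_real ler_norm.
Qed.

(** The left-hand side is at most the squared Hilbert-Schmidt norm of T^n, which
    is computed in the orthonormal basis dl. *)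
Lemma hilbert_schmidt_le r (xi : 'I_r -> H) l n (b : R) :
  orthonormal_fam xi -> (forall x, rnorm (iter n (T l) (dl x)) <= b) ->
  \sum_j rnorm (iter n (T l) (xi j)) ^+ 2 <= #|X|%:R * b ^+ 2.
Proof.
move=> xi_orth le_b.
under eq_bigr do rewrite parseval.
rewrite exchange_big /= mulr_natl -sumr_const; apply: ler_sum => x _.
under eq_bigr do rewrite iter_selfadjoint dotC rnorm_conj.
apply: le_trans (Bessel xi_orth _) _.
by rewrite lerXn2r // nnegrE ?rnorm_ge0 // (le_trans _ (le_b x)) // rnorm_ge0.
Qed.

(** Take an orthonormal family, of largest possible cardinality, of bad vectors:
    unit vectors xi with |Y_l xi|^2 > c for some l.  A bad vector has
    |T_l^N xi| > c^N for N = 2^s and some l by [power_mean], so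
    [hilbert_schmidt_le], summed over l, bounds the size of the family.  By
    maximality no unit vector orthogonal to the family is bad. *)
Lemma trimming (c b eps : R) s : 0 < c -> 0 <= eps ->
  (forall l x, rnorm (iter (2 ^ s) (T l) (dl x)) <= b) ->
  #|La|%:R * b ^+ 2 <= eps * (c ^+ (2 ^ s)) ^+ 2 ->
  exists r (xi : 'I_r -> H), [/\ orthonormal_fam xi, r%:R <= eps * #|X|%:R
    & forall h, (forall j, hdot H h (xi j) = 0) ->
      forall l, rnorm (Y l h) ^+ 2 <= c * rnorm h ^+ 2].
Proof.
move=> c0 eps0 le_b le_eps.
pose bad r := exists xi : 'I_r -> H,
  orthonormal_fam xi /\ forall j, exists l, c < rnorm (Y l (xi j)) ^+ 2.
have bad_le r : bad r -> r%:R <= eps * #|X|%:R.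
  move=> [xi [xi_orth xi_bad]].
  have cq : 0 < (c ^+ (2 ^ s)) ^+ 2 by rewrite !exprn_gt0.
  rewrite -(ler_pM2r cq).
  apply: (@le_trans _ _ (\sum_l \sum_j rnorm (iter (2 ^ s) (T l) (xi j)) ^+ 2)).
    rewrite exchange_big /= mulr_natl -[in leLHS](card_ord r) -sumr_const.
    apply: ler_sum => j _; have [l l_bad] := xi_bad j.
    rewrite (bigD1 l) //= -[leLHS]addr0 lerD //; last first.
      by apply: sumr_ge0 => l' _; exact: sqr_ge0.
    rewrite lerXn2r ?nnegrE ?rnorm_ge0 ?exprn_ge0 ?(ltW c0) //.
    apply: le_trans (power_mean _ _ _).
      by rewrite lerXn2r ?nnegrE ?sqr_ge0 ?(ltW c0) ?(ltW l_bad).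
    have := xi_orth j j; rewrite dotxx eqxx => -[/eqP].
    by rewrite sqrp_eq1 ?rnorm_ge0 // => /eqP.
  apply: (@le_trans _ _ (\sum_(l : La) #|X|%:R * b ^+ 2)).
    by apply: ler_sum => l _; exact: hilbert_schmidt_le.
  rewrite sumr_const -[X in X <= _]mulr_natl mulrCA [eps * _]mulrC -[leRHS]mulrA.
  by rewrite ler_wpM2l.
have [N N_gt] : exists N, eps * #|X|%:R < N%:R.
  by exists (Num.bound (eps * #|X|%:R)); apply: archi_boundP; rewrite mulr_ge0.
have bad0 : exists r, `[< bad r >].
  by exists 0%N; apply/asboolP; exists (fun=> 0); split; case.
have bad_bound r : `[< bad r >] -> (r <= N)%N.
  move=> /asboolP/bad_le rX; rewrite -(@ler_nat R) (le_trans rX) // ltW //.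
(* A bad vector orthogonal to a family of largest size would extend it. *)
case: (ex_maxnP bad0 bad_bound) => r /asboolP br r_max.
have r_le := bad_le r br; case: br => xi [xi_orth xi_bad].
exists r, xi; split=> // h h_orth l.
have [h0|hN0] := eqVneq (rnorm h) 0.
  by rewrite h0 (rnorm_eq0 h0) lin0 // rnorm0 !expr0n mulr0.
have hp : 0 < rnorm h by rewrite lt_def hN0 rnorm_ge0.
rewrite leNgt; apply/negP => h_bad.
pose a : R[i] := ((rnorm h)^-1)%:C%C.
have ra : rnorm a = (rnorm h)^-1 by rewrite rnorm_real ger0_norm // invr_ge0 ltW.
have : (r.+1 <= r)%N; last by rewrite ltnn.
apply: r_max; apply/asboolP; exists (fun j => oapp xi (a *: h) (unlift ord_max j)).
split.
  apply: orthonormal_extend => //; first by rewrite rnormZ ra mulVf.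
  by move=> j; rewrite dotZl h_orth mulr0.
move=> j /=; case: (unliftP ord_max j) => [j' _|_] /=; first exact: xi_bad.
exists l; rewrite linZ // rnormZ ra exprMn exprVn mulrC ltr_pdivlMr ?exprn_gt0 //.
Qed.

End Trimming.

(** * Permutation operators of words *)
Section EuclideanSpace.
Variables (R : realType) (X : finType).

Definition ell2 : hilbertSpace R := hsum_hilbert (scalar_hilbert R) X.
Definition entry (h : ell2) (x : X) : R[i] := (h : hsum (scalar_hilbert R) X) x.
Definition vec (f : X -> R[i]) : ell2 := [ffun x => f x : scalar_hilbert R].
Definition delta (x : X) : ell2 := vec (fun y => (x == y)%:R).

Lemma entry_vec f x : entry (vec f) x = f x.
Proof. by rewrite /entry ffunE. Qed.

Lemma vec_eqP (h k : ell2) : (forall x, entry h x = entry k x) -> h = k.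
Proof. by move=> hk; apply/ffunP => x; exact: hk. Qed.

Lemma entryD h k x : entry (h + k) x = entry h x + entry k x.
Proof. by rewrite /entry ffunE. Qed.

Lemma entryB h k x : entry (h - k) x = entry h x - entry k x.
Proof. by rewrite /entry !ffunE. Qed.

Lemma entryZ a h x : entry (a *: h) x = a * entry h x.
Proof. by rewrite /entry ffunE. Qed.

Lemma entry_linear x : linear (fun h : ell2 => entry h x).
Proof. by move=> a h k; rewrite /entry !ffunE. Qed.

Lemma entry_sum (I : Type) (r : seq I) (P : pred I) (f : I -> ell2) x :
  entry (\sum_(i <- r | P i) f i) x = \sum_(i <- r | P i) entry (f i) x.
Proof.
elim/big_ind2: _ => [|h y k z <- <-|//]; first by rewrite /entry ffunE.
exact: entryD.
Qed.

Lemma dotE (h k : ell2) : hdot ell2 h k = \sum_x entry h x * Num.conj (entry k x).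
Proof. by []. Qed.

Lemma dot_delta h x : hdot ell2 h (delta x) = entry h x.
Proof.
rewrite dotE (bigD1 x) //= entry_vec eqxx conjC1 mulr1 big1 ?addr0 // => y yx.
by rewrite entry_vec eq_sym (negbTE yx) conjC0 mulr0.
Qed.

Lemma rnorm_ell2 (h : ell2) : rnorm h ^+ 2 = \sum_x rnorm (entry h x) ^+ 2.
Proof. by rewrite (rnorm_hsum (h : hsum (scalar_hilbert R) X)) sqr_l2 big_enum. Qed.

Lemma ell2_parseval (h : ell2) :
  rnorm h ^+ 2 = \sum_x rnorm (hdot ell2 h (delta x)) ^+ 2.
Proof. by rewrite rnorm_ell2; apply: eq_bigr => x _; rewrite dot_delta. Qed.

End EuclideanSpace.

Section WordOperators.
Variables (R : realType) (A : finType) (d n : nat) (t : A -> 'I_n -> 'I_n).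
Hypothesis tK : forall k, involutive (t k).
Local Notation K := (ell2 R 'I_n).
Local Notation C := R[i].
Implicit Types (b : seq A -> C) (u w : seq A) (h : K).

(** The last letter of u acts first, in agreement with [wact]. *)
Definition move u (x : 'I_n) : 'I_n := foldr t x u.

Lemma moveK u x : move (rev u) (move u x) = x.
Proof.
elim: u => //= k u IH.
by rewrite rev_cons -cats1 /move foldr_cat /= tK.
Qed.

Lemma moveVK u x : move u (move (rev u) x) = x.
Proof. by rewrite -{1}(revK u) moveK. Qed.

Lemma move_lact k w x : move (lact k w) x = t k (move w x).
Proof. by case: w => //= k' w; case: eqVneq => //= ->; rewrite tK. Qed.

Lemma move_wact u w x : move (wact u w) x = move u (move w x).
Proof. by elim: u => //= k u IH; rewrite move_lact IH. Qed.

(** The unitary operator sending the basis vector at x to the one at u x, see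
    [word_op_delta]. *)
Definition word_op u h : K := vec (fun y => entry h (move (rev u) y)).

Lemma word_opE u h x : entry (word_op u h) x = entry h (move (rev u) x).
Proof. exact: entry_vec. Qed.

Lemma deltaE (x y : 'I_n) : entry (delta R x) y = (x == y)%:R.
Proof. exact: entry_vec. Qed.

Definition word_comb b h : K := \sum_(u <- words A d) b u *: word_op u h.

Definition reduced_supp b := forall u, ~~ reduced u -> b u = 0.

Definition wnorm b : R := l2 (words A d) (fun u => rnorm (b u)).

Lemma word_op_linear u : linear (word_op u).
Proof.
move=> a h k; apply: vec_eqP => x; rewrite (entry_linear x) !word_opE.
exact: entry_linear.
Qed.

Lemma word_comb_linear b : linear (word_comb b).
Proof.
move=> a h k; rewrite /word_comb scaler_sumr -big_split; apply: eq_bigr => u _.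
by rewrite word_op_linear scalerDr !scalerA mulrC.
Qed.

Lemma word_op_norm u h : rnorm (word_op u h) = rnorm h.
Proof.
apply/eqP; rewrite -(@eqrXn2 _ 2) ?rnorm_ge0 // !rnorm_ell2; apply/eqP.
rewrite (reindex (move u)) /=; last first.
  by exists (move (rev u)) => x _; rewrite ?moveK ?moveVK.
by apply: eq_bigr => x _; rewrite word_opE moveK.
Qed.

Lemma word_op_delta u x : word_op u (delta R x) = delta R (move u x).
Proof.
apply: vec_eqP => y; rewrite word_opE !deltaE; congr (nat_of_bool _)%:R.
by apply/eqP/eqP => [->|<-]; rewrite ?moveK ?moveVK.
Qed.

Lemma word_op_adj u h k : hdot K (word_op u h) k = hdot K h (word_op (rev u) k).
Proof.
rewrite !dotE (reindex (move u)) /=; last first.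
  by exists (move (rev u)) => x _; rewrite ?moveK ?moveVK.
by apply: eq_bigr => x _; rewrite !word_opE moveK revK.
Qed.

(** The generators are involutions, so the inverse of a word is its reverse. *)
Definition adj_coef b u := Num.conj (b (rev u)).

Lemma perm_words_rev : perm_eq (words A d) [seq rev u | u <- words A d].
Proof.
have inj : injective (@rev A) by exact: (can_inj revK).
apply: uniq_perm => [||u]; first exact: uniq_words.
  by rewrite (map_inj_uniq inj) uniq_words.
by rewrite -[in RHS](revK u) mem_map // !mem_words size_rev.
Qed.

Lemma word_comb_adj b h k :
  hdot K (word_comb b h) k = hdot K h (word_comb (adj_coef b) k).
Proof.
rewrite dot_suml dot_sumr (perm_big _ perm_words_rev) big_map.
apply: eq_bigr => u _; rewrite dotZl dotZr word_op_adj revK.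
by rewrite /adj_coef conjCK.
Qed.

Lemma wnorm_adj b : wnorm (adj_coef b) = wnorm b.
Proof.
rewrite /wnorm /l2 [in RHS](perm_big _ perm_words_rev) /= big_map.
by congr Num.sqrt; apply: eq_bigr => u _; rewrite rnorm_conj.
Qed.

Lemma reduced_supp_adj b : reduced_supp b -> reduced_supp (adj_coef b).
Proof.
move=> b_red u u_red; rewrite /adj_coef b_red ?conjC0 //.
rewrite /reduced rev_sorted; apply: contra u_red.
by rewrite /reduced; under eq_sorted do rewrite eq_sym.
Qed.

Lemma word_comb_le_sum b h :
  rnorm (word_comb b h) <= (\sum_(u <- words A d) rnorm (b u)) * rnorm h.
Proof.
apply: le_trans (rnorm_sum _ _ _) _; rewrite mulr_suml; apply: ler_sum => u _.
by rewrite rnormZ word_op_norm.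
Qed.

End WordOperators.

(** * Haagerup's inequality near a point *)
Section LocalHaagerup.
Variables (R : realType) (A : finType) (d n ell : nat) (t : A -> 'I_n -> 'I_n).
Hypothesis tK : forall k, involutive (t k).
Hypothesis girth : forall u x, (size u <= ell + ell)%N -> foldr t x u = x ->
  wact u [::] = [::].
Local Notation K := (ell2 R 'I_n).
Local Notation C := R[i].
Local Notation move := (move t).
Local Notation word_comb := (word_comb d t).
Implicit Types (b F : seq A -> C) (u w : seq A) (h : K).

(** Within distance ell of a point, the Schreier graph is a tree. *)
Lemma move_inj_reduced w w' x : reduced w -> reduced w' ->
  (size w <= ell)%N -> (size w' <= ell)%N -> move w x = move w' x -> w = w'.
Proof.
move=> red red' sw sw' ww'.
have : wact (rev w' ++ w) [::] = [::].
  apply: (@girth _ x); first by rewrite size_cat size_rev leq_add.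
  by rewrite foldr_cat -/(move w x) ww'; exact: (moveK tK).
rewrite /wact foldr_cat -/(wact w [::]) wact_nil // => /(congr1 (wact w')).
have := wactK (rev w') red; rewrite revK => -> ->; exact: wact_nil.
Qed.

(** The image on l_2^n, under w |-> w x, of a function F on words. *)
Definition spread (x : 'I_n) r F : K := \sum_(w <- words_le A r) F w *: delta R (move w x).

(** h is supported in the ball of radius r around x and comes from a function of
    l_2 norm at most M on the tree.  The norm is measured on the tree, where it
    makes sense for every r; it agrees with that of h for r <= ell, see
    [spread_norm]. *)
Definition spread_le (x : 'I_n) (r : nat) (M : R) (h : K) : Prop :=
  exists F, [/\ forall w, F w != 0 -> reduced w && (size w <= r)%N,
    h = spread x r F & l2 (words_le A r) (fun w => rnorm (F w)) <= M].

Lemma entry_spread x r F w : (r <= ell)%N ->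
  (forall w, F w != 0 -> reduced w && (size w <= r)%N) -> F w != 0 ->
  entry (spread x r F) (move w x) = F w.
Proof.
move=> r_ell F_supp Fw; have /andP[red sw] := F_supp w Fw.
rewrite /spread entry_sum; under eq_bigr do rewrite entryZ deltaE.
rewrite (bigD1_seq w) ?uniq_words_le ?mem_words_le //= eqxx mulr1.
rewrite big1_seq ?addr0 // => w' /andP[w'w _].
have [F0|/F_supp/andP[red' sw']] := eqVneq (F w') 0; first by rewrite F0 mul0r.
case: eqVneq => [ww'|_]; last by rewrite mulr0.
have := move_inj_reduced red' red (leq_trans sw' r_ell) (leq_trans sw r_ell) ww'.
by move/eqP; rewrite (negbTE w'w).
Qed.

Lemma spread_norm x r M h : (r <= ell)%N -> spread_le x r M h -> rnorm h <= M.
Proof.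
move=> r_ell [F [F_supp -> F_le]]; apply: le_trans F_le.
rewrite -(@ler_pXn2r _ 2) ?nnegrE ?rnorm_ge0 ?l2_ge0 // [leRHS]sqr_l2.
rewrite le_eqVlt; apply/orP; left; apply/eqP; apply: (@complexI R).
transitivity (hdot K (spread x r F) (spread x r F)); first by rewrite dotxx.
rewrite [RHS]rmorph_sum {1}/spread dot_suml; apply: eq_bigr => w _.
rewrite dotZl dotC dot_delta.
have [F0|F0] := eqVneq (F w) 0; first by rewrite F0 mul0r rnorm0 expr0n.
by rewrite entry_spread // conj_mul.
Qed.

Lemma spread_delta x : spread_le x 0 1 (delta R x).
Proof.
exists (fun w => (w == [::])%:R).
have w0 : perm_eq (words_le A 0) [:: [::]].
  apply: uniq_perm => [||w]; rewrite ?uniq_words_le //.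
  by rewrite mem_words_le inE leqn0 size_eq0.
split.
- by move=> w; case: (eqVneq w [::]) => [->|_] //; rewrite eqxx.
- by rewrite /spread (perm_big _ w0) big_seq1 eqxx scale1r.
by rewrite /l2 (perm_big _ w0) big_seq1 eqxx rnorm1 expr1n sqrtr1.
Qed.

(** On spread functions the operator of b is the convolution by b on the tree.
    Pairing the result F' with itself and applying [haagerup_inequality] bounds
    |F'|^2 by (d + 1) |b| |F| |F'|. *)
Lemma spread_step x r M b h : reduced_supp b -> spread_le x r M h ->
  spread_le x (r + d) (d.+1%:R * wnorm d b * M) (word_comb b h).
Proof.
move=> b_red [F [F_supp -> F_le]].
pose F' v := \sum_(w <- words_le A r) \sum_(u <- words A d) b u * F w * (wact u w == v)%:R.
have F'_supp w : F' w != 0 -> reduced w && (size w <= r + d)%N.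
  apply: contraNT => w_out; apply/eqP; rewrite /F' big_seq big1 // => v _.
  rewrite big_seq big1 // => u; rewrite mem_words => /eqP su.
  have [Fv0|/F_supp/andP[v_red sv]] := eqVneq (F v) 0; first by rewrite Fv0 mulr0 mul0r.
  case: eqVneq => [uv|]; last by rewrite mulr0.
  move: w_out; rewrite -uv wact_reduced //=.
  by rewrite (leq_trans (size_wact u v)) // su addnC leq_add2r.
exists F'; split=> //.
  rewrite /word_comb /spread.
  transitivity (\sum_(w <- words_le A r) \sum_(u <- words A d)
      (b u * F w) *: delta R (move (wact u w) x)).
    rewrite exchange_big /=; apply: eq_bigr => u _.
    rewrite (lin_sum _ _ _ (word_op_linear t u)) scaler_sumr; apply: eq_bigr => w _.
    by rewrite (linZ _ _ (word_op_linear t u)) (word_op_delta _ tK) scalerA (move_wact tK).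
  transitivity (\sum_(v <- words_le A (r + d)) \sum_(w <- words_le A r)
     \sum_(u <- words A d) (b u * F w * (wact u w == v)%:R) *: delta R (move v x)).
    rewrite [RHS]exchange_big /= big_seq [RHS]big_seq; apply: eq_bigr => w.
    rewrite mem_words_le => sw; rewrite [RHS]exchange_big /= big_seq [RHS]big_seq.
    apply: eq_bigr => u; rewrite mem_words => /eqP su.
    have uw : wact u w \in words_le A (r + d).
      by rewrite mem_words_le (leq_trans (size_wact u w)) // su addnC leq_add2r.
    rewrite (bigD1_seq _ uw) ?uniq_words_le //= eqxx mulr1 big1 ?addr0 // => v.
    by rewrite eq_sym => /negbTE ->; rewrite mulr0 scale0r.
  apply: eq_bigr => v _; rewrite scaler_suml; apply: eq_bigr => w _.
  by rewrite scaler_suml.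
pose N := l2 (words_le A (r + d)) (fun w => rnorm (F' w)).
have [N0|NN0] := eqVneq N 0.
  rewrite -/N N0 !mulr_ge0 ?l2_ge0 //; apply: le_trans F_le; exact: l2_ge0.
have N_gt0 : 0 < N by rewrite lt_def NN0 l2_ge0.
rewrite -/N -(ler_pM2r N_gt0) -expr2 sqr_l2.
apply: (@le_trans _ _ (\sum_(u <- words A d | reduced u) \sum_(w <- words_le A r)
   rnorm (b u) * rnorm (F w) * rnorm (F' (wact u w)))).
  apply: (@le_trans _ _ (\sum_(v <- words_le A (r + d)) \sum_(w <- words_le A r)
     \sum_(u <- words A d | reduced u)
        (rnorm (b u) * rnorm (F w) * rnorm (F' v) * (wact u w == v)%:R))).
    apply: ler_sum => v _; rewrite expr2 {1}/F'.
    apply: le_trans (ler_wpM2r (rnorm_ge0 _) (rnorm_sum _ _ _)) _.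
    rewrite mulr_suml; apply: ler_sum => w _.
    apply: le_trans (ler_wpM2r (rnorm_ge0 _) (rnorm_sum _ _ _)) _.
    rewrite mulr_suml [leRHS]big_mkcond; apply: ler_sum => u _.
    case: ifPn => [_|/b_red ->]; last by rewrite !mul0r rnorm0 mul0r.
    by rewrite !rnormM mulrAC; case: (_ == _); rewrite /= ?rnorm1 ?rnorm0.
  rewrite exchange_big /= [leRHS]exchange_big /=.
  rewrite big_seq [leRHS]big_seq; apply: ler_sum => w; rewrite mem_words_le => sw.
  rewrite exchange_big /= big_seq_cond [leRHS]big_seq_cond.
  apply: ler_sum => u; rewrite mem_words => /andP[/eqP su _].
  have uw : wact u w \in words_le A (r + d).
    by rewrite mem_words_le (leq_trans (size_wact u w)) // su addnC leq_add2r.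
  rewrite (bigD1_seq _ uw) ?uniq_words_le //= eqxx mulr1 big1 ?addr0 // => v.
  by rewrite eq_sym => /negbTE ->; rewrite mulr0.
apply: le_trans (@haagerup_inequality R A d r (r + d)%N (fun u => rnorm (b u))
  (fun w => rnorm (F w)) (fun w => rnorm (F' w)) (fun=> rnorm_ge0 _)
  (fun=> rnorm_ge0 _) (fun=> rnorm_ge0 _) (leqnn _)) _.
rewrite -!mulrA ler_wpM2l // ler_wpM2l ?l2_ge0 // ler_wpM2r ?l2_ge0 //.
apply: le_trans F_le; rewrite ler_wsqrtr //.
rewrite (bigID (fun w => size w <= r)%N) /= [X in _ + X]big1 ?addr0 => [|w w_out].
  apply: (@ler_sum_inj _ _ _ _ _ _ id (fun w => rnorm (F w) ^+ 2)) => //.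
  - exact: uniq_words_le.
  - by move=> w; exact: sqr_ge0.
  - by move=> w _; rewrite mem_words_le.
suff -> : F w = 0 by rewrite rnorm0 expr0n.
by apply: contraNeq w_out => /F_supp/andP[].
Qed.

End LocalHaagerup.

(** * A nearly free family of permutations *)
Section Rounding.
Variables (R : realType) (K : nat).
Hypothesis K_gt0 : (0 < K)%N.

(** The multiples of 1/K in [-1, 1]; rounding towards 0 does not increase the
    modulus, so that a unit ball is rounded into itself. *)
Definition grid_val (z : bool * 'I_K.+1) : R := (-1) ^+ z.1 * (z.2%:R / K%:R).

Lemma grid_round (x : R) : `|x| <= 1 ->
  exists z, `|grid_val z| <= `|x| /\ `|x - grid_val z| <= K%:R^-1.
Proof.
move=> x1; have K0 : 0 < K%:R :> R by rewrite ltr0n.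
pose y := K%:R * `|x|; have y0 : 0 <= y by rewrite mulr_ge0.
have /andP[jy yj] := truncn_itv y0; set j := Num.truncn y in jy yj.
have jK : (j < K.+1)%N.
  by rewrite ltnS -(ler_nat R) (le_trans jy) // /y -[leRHS]mulr1 ler_wpM2l.
exists (x < 0, Ordinal jK); rewrite /grid_val /=.
have le1 : j%:R / K%:R <= `|x| by rewrite ler_pdivrMr // mulrC.
split; first by rewrite normrM normr_sign mul1r ger0_norm // divr_ge0.
have -> : x - (-1) ^+ (x < 0)%R * (j%:R / K%:R) =
    (-1) ^+ (x < 0)%R * (`|x| - j%:R / K%:R).
  by rewrite mulrBr -{1}(@realEsign _ x) ?num_real.
rewrite normrM normr_sign mul1r ger0_norm ?subr_ge0 // lerBlDr -[X in X + _]mul1r -mulrDl.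
by rewrite ler_pdivlMr // mulrC -/y nat1r ltW.
Qed.

Definition grid_cval (z : (bool * 'I_K.+1) * (bool * 'I_K.+1)) : R[i] :=
  (grid_val z.1 +i* grid_val z.2)%C.

Lemma rnorm_complex (x : R[i]) :
  rnorm x = Num.sqrt (complex.Re x ^+ 2 + complex.Im x ^+ 2).
Proof. by rewrite /rnorm normc_def. Qed.

Lemma grid_cround (x : R[i]) : rnorm x <= 1 ->
  exists z, rnorm (grid_cval z) <= rnorm x /\ rnorm (x - grid_cval z) <= 2 / K%:R.
Proof.
move=> x1.
have [z1 [le1 d1]] := grid_round (le_trans (Re_norm_le x) x1).
have [z2 [le2 d2]] := grid_round (le_trans (Im_norm_le x) x1).
exists (z1, z2); split.
  rewrite !rnorm_complex ler_wsqrtr // lerD //= -[leLHS]real_normK ?num_real //;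
    by rewrite -[leRHS]real_normK ?num_real // lerXn2r // nnegrE.
apply: le_trans (norm_le_ReIm _) _; rewrite mulr2n mulrDl mul1r.
by case: x {x1 le1 le2} d1 d2 => a b /= d1 d2; apply: lerD.
Qed.

End Rounding.

Lemma pow_unbounded (R : realType) (rho y : R) : 1 < rho -> exists s, y <= rho ^+ (2 ^ s).
Proof.
move=> rho1; have e0 : 0 < rho - 1 by rewrite subr_gt0.
have bernoulli n : 1 + (rho - 1) * n%:R <= rho ^+ n.
  elim: n => [|n IH]; first by rewrite mulr0 addr0 expr0.
  rewrite exprS; apply: le_trans (ler_wpM2l (ltW (lt_trans ltr01 rho1)) IH).
  rewrite -subr_ge0.
  have -> : rho * (1 + (rho - 1) * n%:R) - (1 + (rho - 1) * n.+1%:R) =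
    (rho - 1) ^+ 2 * n%:R by rewrite -natr1; ring.
  by rewrite mulr_ge0 ?sqr_ge0.
pose n := Num.bound (`|y| / (rho - 1)); exists n.
apply: le_trans (ler_norm y) _; apply: le_trans (bernoulli _).
have : `|y| / (rho - 1) < n%:R by apply: archi_boundP; rewrite divr_ge0 // ltW.
rewrite ltr_pdivrMr // => /ltW yn; apply: le_trans yn _.
rewrite mulrC -[leLHS]add0r lerD // ler_pM2l // ler_nat ltnW // ltn_expl //.
Qed.

Section NearlyFree.
Variables (R : realType) (A : finType) (d : nat).
Local Notation C := R[i].
Implicit Types (b : seq A -> C).

(** The powers of T = Y^* Y used here keep the basis vector at x inside the ball
    where the Schreier graph is a tree, hence each factor Y or Y^* costs at most
    d + 1 by [spread_step]. *)
Lemma word_comb_moment_le n ell (t : A -> 'I_n -> 'I_n) b q x :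
  (forall k, involutive (t k)) ->
  (forall u x, (size u <= ell + ell)%N -> foldr t x u = x -> wact u [::] = [::]) ->
  (q * (d + d) <= ell)%N -> reduced_supp b -> wnorm d b <= 1 ->
  rnorm (iter q (fun h => word_comb d t (adj_coef b) (word_comb d t b h)) (delta R x)) <=
    (d.+1%:R ^+ 2) ^+ q.
Proof.
move=> tK girth q_ell b_red b1.
suff : spread_le t x (q * (d + d)) (((d.+1%:R * wnorm d b) ^+ 2) ^+ q)
  (iter q (fun h => word_comb d t (adj_coef b) (word_comb d t b h)) (delta R x)).
  move/(spread_norm tK girth q_ell) => /le_trans; apply.
  rewrite lerXn2r ?nnegrE ?sqr_ge0 // lerXn2r ?nnegrE ?mulr_ge0 ?l2_ge0 //.
  by rewrite -[leRHS]mulr1 ler_wpM2l.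
elim: q {q_ell} => [|q IH]; first exact: spread_delta.
rewrite iterS mulSnr addnA.
have := spread_step d tK (reduced_supp_adj b_red) (spread_step d tK b_red IH).
by rewrite wnorm_adj mulrA -expr2 -exprS.
Qed.

Section Net.
Variable K : nat.
Local Notation code := {ffun d.-tuple A -> (bool * 'I_K.+1) * (bool * 'I_K.+1)}.

(** A code l lists the rounded coefficients of a function on the words of length
    d, non-reduced words getting 0. *)
Definition net_raw (l : code) (u : seq A) : C :=
  if insub u is Some tu then
    if reduced u then grid_cval R (l (tu : d.-tuple A)) else 0
  else 0.

(** Codes outside the unit ball are sent to 0, so that every point of the net has
    norm at most 1. *)
Definition net_coef (l : code) (u : seq A) : C :=
  if wnorm d (net_raw l) <= 1 then net_raw l u else 0.

Lemma net_coef_red l : reduced_supp (net_coef l).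
Proof.
move=> u /negbTE u_red; rewrite /net_coef /net_raw u_red.
by case: ifP => // _; case: insubP.
Qed.

Lemma wnorm0 b : (forall u, b u = 0) -> wnorm d b = 0.
Proof.
by move=> b0; rewrite /wnorm /l2 big1 ?sqrtr0 // => u _; rewrite b0 rnorm0 expr0n.
Qed.

Lemma net_coef_le1 l : wnorm d (net_coef l) <= 1.
Proof.
have [le1|/negbTE gt1] := boolP (wnorm d (net_raw l) <= 1).
  suff -> : net_coef l = net_raw l by [].
  by apply/funext => u; rewrite /net_coef le1.
by rewrite wnorm0 // => u; rewrite /net_coef gt1.
Qed.

Lemma net_dense b : (0 < K)%N -> reduced_supp b -> wnorm d b <= 1 ->
  exists l, forall u, u \in words A d -> rnorm (b u - net_coef l u) <= 2 / K%:R.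
Proof.
move=> K0 b_red b1.
have b_le u : u \in words A d -> rnorm (b u) <= 1.
  move=> uW; apply: le_trans b1; rewrite -[leLHS]ger0_norm ?rnorm_ge0 // -sqrtr_sqr.
  by rewrite ler_wsqrtr // (bigD1_seq u) ?uniq_words //= lerDl sum_sqr_ge0.
have mem_val (tu : d.-tuple A) : val tu \in words A d by rewrite mem_words size_tuple.
have round (tu : d.-tuple A) : exists z : (bool * 'I_K.+1) * (bool * 'I_K.+1),
    rnorm (grid_cval R z) <= rnorm (b tu) /\ rnorm (b tu - grid_cval R z) <= 2 / K%:R.
  by apply: grid_cround => //; apply: b_le; exact: mem_val.
pose l : code := [ffun tu => sval (cid (round tu))].
have rawP u : u \in words A d ->
    rnorm (net_raw l u) <= rnorm (b u) /\ rnorm (b u - net_raw l u) <= 2 / K%:R.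
  rewrite mem_words => su; rewrite /net_raw insubT /=.
  case: ifPn => [_|u_red]; last by rewrite b_red // subr0 rnorm0; split=> //; rewrite divr_ge0.
  by rewrite ffunE; case: cid => z /=.
have raw1 : wnorm d (net_raw l) <= 1.
  apply: le_trans b1; rewrite ler_wsqrtr // big_seq [leRHS]big_seq.
  apply: ler_sum => u /rawP[le_b _].
  by rewrite lerXn2r // nnegrE rnorm_ge0.
by exists l => u /rawP[_]; rewrite /net_coef raw1.
Qed.

End Net.

(** Haagerup's inequality gives d + 1 for the moments.  Trimming at the level
    d + 4/3 removes an arbitrarily small proportion of the dimension once the
    moments are high enough, the ratio ((d + 4/3) / (d + 1))^(2^s) being
    unbounded while the size of the net is fixed; the proportion 1/12 is enough.
    The last 1/3 absorbs the distance from b to the net.  The constants are such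
    that (d + 5/3) (12/11) is at most 4^(d-1) for d >= 2, with equality for
    d = 2. *)
Lemma nearly_free : exists n (t : A -> 'I_n -> 'I_n) r (xi : 'I_r -> ell2 R 'I_n),
  [/\ (0 < n)%N, forall k, involutive (t k), orthonormal_fam xi,
      r%:R * 12%:R <= n%:R :> R
    & forall b h, reduced_supp b -> (forall j, hdot (ell2 R 'I_n) h (xi j) = 0) ->
        rnorm (word_comb d t b h) <= (d%:R + 5%:R / 3%:R) * wnorm d b * rnorm h].
Proof.
(* W coefficients with an error 2 / K each stay below 1/3. *)
pose W := size (words A d); pose K := (6 * W).+1.
pose code := {ffun d.-tuple A -> (bool * 'I_K.+1) * (bool * 'I_K.+1)}.
pose c : R := (d%:R + 4%:R / 3%:R) ^+ 2.
have d0 : 0 <= d%:R :> R by [].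
have c0 : 0 < c by rewrite exprn_gt0 //; lra.
have B0 : 0 < d.+1%:R ^+ 2 :> R by rewrite exprn_gt0 // ltr0n.
have rho1 : 1 < (c / d.+1%:R ^+ 2) ^+ 2.
  rewrite exprn_egt1 // ltr_pdivlMr // mul1r /c -natr1 ltrXn2r ?nnegrE //; lra.
have [s s_big] := pow_unbounded (12%:R * #|{: code}|%:R) rho1.
pose ell := (2 ^ s * (d + d))%N.
have [n [t [n0 tK girth]]] := large_girth A (ell + ell).
pose Y (l : code) h := word_comb d t (net_coef l) h : ell2 R 'I_n.
pose Z (l : code) h := word_comb d t (adj_coef (net_coef l)) h : ell2 R 'I_n.
have [] := @trimming R (ell2 R 'I_n) 'I_n (@delta R 'I_n) (@ell2_parseval R 'I_n)
  code Y Z _ _ c ((d.+1%:R ^+ 2) ^+ (2 ^ s)) (12%:R^-1) s c0.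
- by move=> l; exact: word_comb_linear.
- by move=> l x y; exact: word_comb_adj.
- by [].
- move=> l x; apply: (@word_comb_moment_le _ ell) => //; [exact: net_coef_red|exact: net_coef_le1].
- move: s_big; rewrite -exprM mulnC exprM !expr_div_n ler_pdivlMr ?exprn_gt0 // => s_big.
  by rewrite [leRHS]mulrC ler_pdivlMr // mulrC mulrA.
move=> r [xi [xi_orth r_le trim]].
exists n, t, r, xi; split => //.
  by rewrite -ler_pdivlMr // mulrC -[in leRHS](card_ord n).
have d43 : 0 <= d%:R + 4%:R / 3%:R :> R by lra.
have d53 : 0 <= d%:R + 5%:R / 3%:R :> R by lra.
have unit_case b h : reduced_supp b -> (forall j, hdot (ell2 R 'I_n) h (xi j) = 0) ->
    wnorm d b <= 1 -> rnorm (word_comb d t b h) <= (d%:R + 5%:R / 3%:R) * rnorm h.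
  move=> b_red h_orth b1.
  have [l l_close] := net_dense (K := K) erefl b_red b1.
  have -> : word_comb d t b h = Y l h + word_comb d t (fun u => b u - net_coef l u) h.
    rewrite /Y /word_comb -big_split; apply: eq_bigr => u _.
    transitivity ((net_coef l u + (b u - net_coef l u)) *: word_op t u h).
      by rewrite addrC subrK.
    exact: scalerDl.
  apply: le_trans (rnormD _ _) _.
  have Yle : rnorm (Y l h) <= (d%:R + 4%:R / 3%:R) * rnorm h.
    rewrite -(@ler_pXn2r _ 2) ?nnegrE ?rnorm_ge0 ?mulr_ge0 ?rnorm_ge0 //.
    by rewrite exprMn; exact: trim.
  have Ele : rnorm (word_comb d t (fun u => b u - net_coef l u) h) <= 3%:R^-1 * rnorm h.
    apply: le_trans (word_comb_le_sum _ tK _ _) _; rewrite ler_wpM2r ?rnorm_ge0 //.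
    rewrite big_seq; apply: le_trans (ler_sum (G := fun=> 2 / K%:R) _ _) _.
      by move=> u uW; exact: l_close.
    rewrite -big_seq big_const_seq count_predT iter_addr addr0 -/W -[X in X <= _]mulr_natr.
    have W0 : 0 <= W%:R :> R by [].
    have KE : K%:R = 6%:R * W%:R + 1 :> R by rewrite /K -natr1 natrM.
    have K0 : 0 < K%:R :> R by rewrite ltr0n.
    rewrite -mulrA [_^-1 * _]mulrC mulrA ler_pdivrMr // KE; lra.
  apply: le_trans (lerD Yle Ele) _; rewrite -mulrDl ler_wpM2r ?rnorm_ge0 //; lra.
move=> b h b_red h_orth.
have [b0|bN0] := eqVneq (wnorm d b) 0.
  rewrite b0 mulr0 mul0r; apply: le_trans (word_comb_le_sum _ tK _ _) _.
  suff -> : \sum_(u <- words A d) rnorm (b u) = 0 by rewrite mul0r.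
  apply: le_anti; rewrite sumr_ge0 ?andbT => [|u _]; last exact: rnorm_ge0.
  have := sum_mul_le_l2 (words A d) (fun=> 1) (fun u => rnorm (b u)).
  by rewrite -/(wnorm d b) b0 mulr0; under eq_bigr do rewrite mul1r.
have b_gt0 : 0 < wnorm d b by rewrite lt_def bN0 l2_ge0.
pose a : C := (wnorm d b)%:C%C.
have a0 : a != 0 by rewrite /a eq_complex /= (negbTE bN0).
pose b' u := a^-1 * b u.
have -> : word_comb d t b h = a *: word_comb d t b' h.
  rewrite /word_comb scaler_sumr; apply: eq_bigr => u _.
  by rewrite scalerA /b' mulrA mulfV // mul1r.
rewrite rnormZ rnorm_real ger0_norm ?l2_ge0 // [_ * wnorm d b]mulrC -mulrA.
rewrite ler_wpM2l ?l2_ge0 //; apply: unit_case => //.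
  by move=> u /b_red bu; rewrite /b' bu mulr0.
rewrite /wnorm /b'.
have -> : l2 (words A d) (fun u => rnorm (a^-1 * b u)) =
    (wnorm d b)^-1 * wnorm d b.
  rewrite -l2Z ?invr_ge0 ?l2_ge0 //; congr Num.sqrt; apply: eq_bigr => u _.
  congr (_ ^+ 2); rewrite rnormM; congr (_ * _).
  by rewrite /a -fmorphV rnorm_real ger0_norm // invr_ge0 l2_ge0.
by rewrite mulVf.
Qed.

End NearlyFree.

(** * The Fourier matrix *)
Section Fourier.
Variables (R : realType) (m : nat).
Hypothesis m_gt0 : (0 < m)%N.

Lemma prim_root_ex : exists z : R[i], m.-primitive_root z.
Proof.
have [r Dp] := closed_field_poly_normal ('X^m - 1 : {poly R[i]}).
rewrite (monicP _) ?monicXnsubC // scale1r in Dp.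
have rm : all m.-unity_root r by apply/allP => z; rewrite -root_prod_XsubC -Dp.
have r_size : (m < (size r).+1)%N.
  by rewrite -(size_prod_XsubC r id) -Dp size_XnsubC.
have r_uniq : uniq r.
  rewrite -separable.separable_prod_XsubC -Dp.
  by rewrite cyclotomic.separable_Xn_sub_1 // pnatr_eq0 -lt0n.
by have [z _ z_prim] := hasP (has_prim_root m_gt0 rm r_uniq r_size); exists z.
Qed.

Variable z : R[i].
Hypothesis z_prim : m.-primitive_root z.

(** The unnormalised Fourier matrix: sqrt m times a unitary, with entries of
    modulus 1. *)
Definition fourier (j i : 'I_m) : R[i] := z ^+ (j * i).

Lemma rnorm_z : rnorm z = 1.
Proof.
have : rnorm z ^+ m = 1.
  have -> : rnorm z ^+ m = rnorm (z ^+ m).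
    elim: m => [|n IH]; first by rewrite !expr0 rnorm1.
    by rewrite !exprS rnormM IH.
  by rewrite (prim_expr_order z_prim) rnorm1.
by move/eqP; rewrite pexpr_eq1 ?rnorm_ge0 // => /eqP.
Qed.

Lemma rnormX (x : R[i]) n : rnorm (x ^+ n) = rnorm x ^+ n.
Proof. by elim: n => [|n IH]; rewrite ?expr0 ?rnorm1 // !exprS rnormM IH. Qed.

Lemma rnorm_fourier j i : rnorm (fourier j i) = 1.
Proof. by rewrite rnormX rnorm_z expr1n. Qed.

Lemma fourier_orth (i i' : 'I_m) :
  \sum_j fourier j i * Num.conj (fourier j i') = (i == i')%:R * m%:R.
Proof.
pose x := z ^+ i * Num.conj (z ^+ i').
have zz : z ^+ i' * Num.conj (z ^+ i') = 1.
  by rewrite conj_mul rnormX rnorm_z !expr1n.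
have xE (j : 'I_m) : fourier j i * Num.conj (fourier j i') = x ^+ j.
  by rewrite /fourier /x exprMn -rmorphXn -!exprM [(j * i)%N]mulnC [(j * i')%N]mulnC.
under eq_bigr do rewrite xE.
have [ii'|ii'] := eqVneq i i'.
  rewrite mul1r /x ii' zz; under eq_bigr do rewrite expr1n.
  by rewrite sumr_const card_ord.
rewrite mul0r; apply/eqP; have : (x - 1) * (\sum_(j < m) x ^+ j) == 0.
  rewrite -subrX1 /x exprMn -rmorphXn -!exprM ![(_ * m)%N]mulnC !exprM.
  by rewrite (prim_expr_order z_prim) !expr1n rmorph1 mulr1 subrr.
rewrite mulf_eq0 => /orP[|//]; rewrite subr_eq0 => /eqP x1.
have : z ^+ i = z ^+ i'.
  by rewrite -[LHS]mulr1 -zz mulrCA -/x x1 mulr1.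
move/eqP; rewrite (eq_prim_root_expr z_prim) !modn_small // => /eqP/val_inj/eqP.
by rewrite (negbTE ii').
Qed.

Lemma fourier_parseval (H : hilbertSpace R) (y : 'I_m -> H) :
  \sum_j rnorm (\sum_i fourier j i *: y i) ^+ 2 = m%:R * \sum_i rnorm (y i) ^+ 2.
Proof.
apply: (@complexI R); rewrite rmorph_sum rmorphM rmorph_nat rmorph_sum /=.
transitivity (\sum_j \sum_i \sum_i' (fourier j i * Num.conj (fourier j i')) *
    hdot H (y i) (y i')).
  apply: eq_bigr => j _; rewrite -dotxx dot_suml; apply: eq_bigr => i _.
  rewrite dot_sumr; apply: eq_bigr => i' _; rewrite dotZl dotZr.
  by rewrite mulrA.
rewrite exchange_big mulr_sumr; apply: eq_bigr => i _.
rewrite exchange_big.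
transitivity (\sum_i' (i == i')%:R * m%:R * hdot H (y i) (y i')).
  by apply: eq_bigr => i' _; rewrite -mulr_suml fourier_orth.
rewrite (bigD1 i) // big1 => [|i' i'i]; first by rewrite eqxx mul1r dotxx; exact: addr0.
by rewrite eq_sym (negbTE i'i) !mul0r.
Qed.

Lemma hnorm_fourier (H : hilbertSpace R) (y : 'I_m -> H) :
  hnorm (fun j => \sum_i fourier j i *: y i) = Num.sqrt m%:R * hnorm y.
Proof. by rewrite /hnorm /l2 fourier_parseval sqrtrM. Qed.

Lemma rnorm_sum_le (H : hilbertSpace R) (y : 'I_m -> H) :
  rnorm (\sum_i y i) <= Num.sqrt m%:R * hnorm y.
Proof.
apply: le_trans (rnorm_sum _ _ _) _.
by have := sum_le_sqrt_card_l2 (fun i => rnorm (y i)); rewrite card_ord.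
Qed.

End Fourier.

(** * The test element *)
Section IndexWords.
Variable m : nat.
Local Notation J := 'I_m.
Local Notation A := (bool * 'I_m)%type.

Fixpoint last_idx (k : nat) : tpow_idx J k -> J :=
  match k return tpow_idx J k -> J with 0 => id | k'.+1 => fun I => I.2 end.

(** Two disjoint alphabets alternate along the word, so that it is reduced even
    where consecutive indices coincide. *)
Fixpoint idx_word (k : nat) : tpow_idx J k -> seq A :=
  match k return tpow_idx J k -> seq A with
  | 0 => fun i => [:: (false, i)]
  | k'.+1 => fun I => rcons (idx_word I.1) (odd k'.+1, I.2)
  end.

Lemma size_idx_word k (I : tpow_idx J k) : size (idx_word I) = k.+1.
Proof. by elim: k I => //= k IH I; rewrite size_rcons IH. Qed.

Lemma idx_word_last k (I : tpow_idx J k) x0 : last x0 (idx_word I) = (odd k, last_idx I).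
Proof. by case: k I => //= k I; rewrite last_rcons. Qed.

Lemma idx_word_reduced k (I : tpow_idx J k) : reduced (idx_word I).
Proof.
elim: k I => //= k IH I; rewrite /reduced.
have := IH I.1; have := idx_word_last I.1 (odd k.+1, I.2); have := size_idx_word I.1.
case: (idx_word I.1) => //= a s _ sl red; rewrite rcons_path -/(reduced (a :: s)) red sl.
by rewrite /= xpair_eqE /=; case: (odd k).
Qed.

Lemma idx_word_inj k : injective (@idx_word k).
Proof.
elim: k => [|k IH] /=; first by move=> i j [].
move=> [I i] [I' i'] /= /eqP; rewrite eqseq_rcons => /andP[/eqP/IH -> /eqP[->]].
by [].
Qed.

Lemma card_tpow_idx k : #|tpow_idx J k| = (m ^ k.+1)%N.
Proof. by elim: k => [|k IH] /=; rewrite ?card_ord // card_prod IH card_ord -expnSr. Qed.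

End IndexWords.

Section TestElement.
Variables (R : realType) (m n : nat) (z : R[i]) (t : bool * 'I_m -> 'I_n -> 'I_n).
Hypothesis m_gt0 : (0 < m)%N.
Hypothesis z_prim : m.-primitive_root z.
Hypothesis tK : forall a, involutive (t a).
Local Notation C := R[i].
Local Notation J := 'I_m.
Local Notation P := ('I_m * 'I_n)%type.
Local Notation F := (fourier z).
Local Notation N1 := (fun x : {ffun J -> C} => (ell1_norm x)%:E).
Local Notation E1 := (max_os N1).
Local Notation E k := (@haagerup_pow R J E1 k).

Fixpoint phase (k : nat) : tpow_idx J k -> C :=
  match k return tpow_idx J k -> C with
  | 0 => fun=> 1
  | k'.+1 => fun I => phase I.1 * F (last_idx I.1) I.2
  end.

Lemma rnorm_phase k (I : tpow_idx J k) : rnorm (phase I) = 1.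
Proof.
elim: k I => [|k IH] I /=; first by rewrite rnorm1.
by rewrite rnormM IH rnorm_fourier // mulr1.
Qed.

(** A partial product in the factorization of the test element.  Columns are
    indexed by pairs (i, h) of a last index and a point of 'I_n, since the next
    Fourier factor needs the last index; enumerating the pairs turns them into
    matrix indices. *)
Definition head_mx k : 'M[{ffun tpow_idx J k -> C}]_(n, #|{: P}|) :=
  \matrix_(g, q) [ffun I => phase I * (last_idx I == (enum_val q).1)%:R *
                   (g == move t (idx_word I) (enum_val q).2)%:R].

(** The Fourier matrix times the diagonal matrix of the e_i (x) u_(l, i). *)
Definition step_mx (l : bool) : 'M[{ffun J -> C}]_(#|{: P}|, #|{: P}|) :=
  \matrix_(q, q') [ffun i => F (enum_val q).1 i * (i == (enum_val q').1)%:R *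
                   ((enum_val q).2 == t (l, i) (enum_val q').2)%:R].

(** As [step_mx], with the last index summed over: a column instead of a diagonal
    matrix. *)
Definition tail_mx (l : bool) (s : C) : 'M[{ffun J -> C}]_(#|{: P}|, n) :=
  \matrix_(q, g) [ffun i => s * F (enum_val q).1 i * ((enum_val q).2 == t (l, i) g)%:R].

(** The sum over I of s phase(I) e_I (x) (permutation matrix of the word of I),
    the matrix factor being moved to the outside. *)
Definition test_mx k (s : C) : 'M[{ffun tpow_idx J k -> C}]_n :=
  \matrix_(g, h) [ffun I => s * phase I * (g == move t (idx_word I) h)%:R].

Lemma move_rcons (w : seq (bool * 'I_m)) a (x : 'I_n) :
  move t (rcons w a) x = move t w (t a x).
Proof. by rewrite /move foldr_rcons. Qed.

Lemma sum_enum_val (T : nmodType) (f : P -> T) :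
  \sum_(q < #|{: P}|) f (enum_val q) = \sum_j \sum_h f (j, h).
Proof.
rewrite -(big_enum_val (fun p => f p)) /= pair_bigA.
by apply: eq_big => // -[].
Qed.

Lemma head_mx_step k g q' :
  head_mx k.+1 g q' =
  \sum_(q < #|{: P}|) tens (head_mx k g q) (step_mx (odd k.+1) q q').
Proof.
apply/ffunP => -[I i]; rewrite sum_ffunE !mxE.
under eq_bigr do rewrite !mxE !ffunE /=.
rewrite (sum_enum_val (fun q => phase I * (last_idx I == q.1)%:R *
  (g == move t (idx_word I) q.2)%:R * (F q.1 i * (i == (enum_val q').1)%:R *
  (q.2 == t (~~ odd k, i) (enum_val q').2)%:R))) /= ffunE /=.
rewrite (bigD1 (last_idx I)) //= [X in _ + X]big1 => [|j]; last first.
  by rewrite eq_sym => /negbTE ->; rewrite big1 // => h _; rewrite mulr0 !mul0r.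
rewrite (bigD1 (t (~~ odd k, i) (enum_val q').2)) //= [X in _ + X + _]big1 => [|h].
  rewrite !eqxx move_rcons !mulr1 !addr0 -!mulrA; congr (_ * _).
  by rewrite mulrA mulrC.
by move=> /negbTE ->; rewrite !mulr0.
Qed.

Lemma test_mx_step k s g h :
  test_mx k.+1 s g h =
  \sum_(q < #|{: P}|) tens (head_mx k g q) (tail_mx (odd k.+1) s q h).
Proof.
apply/ffunP => -[I i]; rewrite sum_ffunE !mxE.
under eq_bigr do rewrite !mxE !ffunE /=.
rewrite (sum_enum_val (fun q => phase I * (last_idx I == q.1)%:R *
  (g == move t (idx_word I) q.2)%:R * (s * F q.1 i *
  (q.2 == t (~~ odd k, i) h)%:R))) /= ffunE /=.
rewrite (bigD1 (last_idx I)) //= [X in _ + X]big1 => [|j]; last first.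
  by rewrite eq_sym => /negbTE ->; rewrite big1 // => h' _; rewrite mulr0 !mul0r.
rewrite (bigD1 (t (~~ odd k, i) h)) //= [X in _ + X + _]big1 => [|h'].
  rewrite !eqxx move_rcons !mulr1 !addr0 mulrCA.
  by rewrite mulrAC.
by move=> /negbTE ->; rewrite !mulr0.
Qed.

Section Contraction.
Variables (H : hilbertSpace R) (u : {linear {ffun J -> C} -> (H -> H)}).
Hypothesis u_bounded : forall b, bounded_op (u b).
Hypothesis u_contr : (lin_norm N1 u <= 1)%E.

(** A contraction on l_1^m is a family of m contractions; only this matters for
    the three norm estimates below. *)
Lemma contr_expand b h : u b h = \sum_i b i *: u (basis_vec R i) h.
Proof.
have {1}-> : b = \sum_i b i *: basis_vec R i.
  apply/ffunP => j; rewrite sum_ffunE (bigD1 j) //= big1 => [|i ij].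
    by rewrite !ffunE eqxx addr0; exact: esym (mulr1 _).
  by rewrite !ffunE (negbTE ij); exact: mulr0.
rewrite raddf_sum fct_sumE; apply: eq_bigr => i _ /=.
by rewrite linearZ_LR.
Qed.

Lemma contr_basis i h : rnorm (u (basis_vec R i) h) <= rnorm h.
Proof.
apply: (lin_norm_contr _ (u_bounded _) u_contr).
rewrite lee_fin /ell1_norm (bigD1 i) //= big1 => [|j ji].
  by rewrite ffunE eqxx rnorm1 addr0.
by rewrite ffunE eq_sym (negbTE ji) rnorm0.
Qed.

Lemma hnorm_pairs (f : 'I_#|{: P}| -> H) (g : P -> H) :
  (forall q, f q = g (enum_val q)) ->
  hnorm f = l2 (index_enum 'I_n) (fun h => hnorm (fun j => g (j, h))).
Proof.
move=> fg; rewrite /hnorm /l2; congr Num.sqrt.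
under eq_bigr do rewrite fg.
rewrite (sum_enum_val (fun p => rnorm (g p) ^+ 2)) exchange_big.
by apply: eq_bigr => h _; rewrite sqr_l2.
Qed.

Lemma l2_pairs (v : J -> 'I_n -> H) (l : bool) :
  l2 (index_enum 'I_n) (fun h => hnorm (fun j => v j (t (l, j) h))) =
  l2 (index_enum 'I_n) (fun h => hnorm (fun j => v j h)).
Proof.
rewrite /l2; congr Num.sqrt; under eq_bigr do rewrite sqr_l2.
under [RHS]eq_bigr do rewrite sqr_l2.
rewrite exchange_big [RHS]exchange_big; apply: eq_bigr => j _.
rewrite (reindex_inj (inv_inj (tK (l, j)))).
by apply: eq_bigr => h _; rewrite tK.
Qed.

(** A row of m contractions has norm at most sqrt m. *)
Lemma head_bound (v : 'I_#|{: P}| -> H) :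
  hnorm (mxapp (map_mx u (head_mx 0)) v) <= Num.sqrt m%:R * hnorm v.
Proof.
pose w j h := v (enum_rank (j, h)).
rewrite (@hnorm_pairs v (fun p => w p.1 p.2)); last first.
  by move=> q; rewrite /w -surjective_pairing enum_valK.
rewrite -(l2_pairs _ false) -l2Z //; apply: l2_le => g; rewrite rnorm_ge0 /=.
have -> : mxapp (map_mx u (head_mx 0)) v g =
    \sum_i u (basis_vec R i) (w i (t (false, i) g)).
  rewrite /mxapp; under [LHS]eq_bigr do rewrite mxE contr_expand.
  transitivity (\sum_(q < #|{: P}|) \sum_i ((i == (enum_val q).1)%:R *
      (g == t (false, i) (enum_val q).2)%:R) *:
      u (basis_vec R i) (w (enum_val q).1 (enum_val q).2)).
    apply: eq_bigr => q _; apply: eq_bigr => i _.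
    by rewrite mxE ffunE /= mul1r /w -surjective_pairing enum_valK.
  rewrite (sum_enum_val (fun q => \sum_i ((i == q.1)%:R * (g == t (false, i) q.2)%:R) *:
      u (basis_vec R i) (w q.1 q.2))).
  apply: eq_bigr => j _; rewrite exchange_big (bigD1 j) //= [X in _ + X]big1 => [|i ij].
    rewrite addr0 (bigD1 (t (false, j) g)) //= big1 => [|h hg].
      by rewrite tK !eqxx mulr1 scale1r addr0.
    rewrite (_ : (g == _) = false) ?mulr0 ?scale0r //; apply/eqP => gh.
    by rewrite gh tK eqxx in hg.
  by rewrite big1 // => h _; rewrite (negbTE ij) mul0r scale0r.
apply: le_trans (rnorm_sum_le _) _; rewrite ler_wpM2l // l2_le // => i.
by rewrite rnorm_ge0 contr_basis.
Qed.

(** A diagonal matrix of contractions followed by the Fourier matrix. *)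
Lemma step_bound l (v : 'I_#|{: P}| -> H) :
  hnorm (mxapp (map_mx u (step_mx l)) v) <= Num.sqrt m%:R * hnorm v.
Proof.
pose w j h := v (enum_rank (j, h)).
rewrite (@hnorm_pairs v (fun p => w p.1 p.2)); last first.
  by move=> q; rewrite /w -surjective_pairing enum_valK.
pose y i h := u (basis_vec R i) (w i (t (l, i) h)).
rewrite (@hnorm_pairs (mxapp (map_mx u (step_mx l)) v)
  (fun p => \sum_i F p.1 i *: y i p.2)) /=; last first.
  move=> q; rewrite /mxapp; under [LHS]eq_bigr do rewrite mxE contr_expand.
  transitivity (\sum_(q' < #|{: P}|) \sum_i (F (enum_val q).1 i * (i == (enum_val q').1)%:R *
      ((enum_val q).2 == t (l, i) (enum_val q').2)%:R) *:
      u (basis_vec R i) (w (enum_val q').1 (enum_val q').2)).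
    apply: eq_bigr => q' _; apply: eq_bigr => i _.
    by rewrite mxE ffunE /w -surjective_pairing enum_valK.
  rewrite (sum_enum_val (fun q' => \sum_i (F (enum_val q).1 i * (i == q'.1)%:R *
      ((enum_val q).2 == t (l, i) q'.2)%:R) *: u (basis_vec R i) (w q'.1 q'.2))).
  apply: eq_bigr => j _; rewrite exchange_big (bigD1 j) //= [X in _ + X]big1 => [|i ij].
    rewrite addr0 (bigD1 (t (l, j) (enum_val q).2)) //= big1 => [|h hg].
      by rewrite tK !eqxx !mulr1 addr0.
    rewrite (_ : ((enum_val q).2 == _) = false) ?mulr0 ?scale0r //; apply/eqP => gh.
    by rewrite gh tK eqxx in hg.
  by rewrite big1 // => h _; rewrite (negbTE ij) mulr0 mul0r scale0r.
rewrite -(l2_pairs w l) -l2Z //; apply: l2_le => h; rewrite hnorm_ge0 /=.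
rewrite (hnorm_fourier m_gt0 z_prim (fun i => y i h)) ler_wpM2l // l2_le // => i.
by rewrite rnorm_ge0 contr_basis.
Qed.

(** One factor sqrt m is the norm of the Fourier matrix, the other the norm of a
    column of m contractions. *)
Lemma tail_bound l s (v : 'I_n -> H) :
  hnorm (mxapp (map_mx u (tail_mx l s)) v) <= rnorm s * m%:R * hnorm v.
Proof.
pose y i h := u (basis_vec R i) (v (t (l, i) h)).
rewrite (@hnorm_pairs (mxapp (map_mx u (tail_mx l s)) v)
  (fun p => \sum_i F p.1 i *: (s *: y i p.2))) /=; last first.
  move=> q; rewrite /mxapp; under [LHS]eq_bigr do rewrite mxE contr_expand.
  rewrite exchange_big; apply: eq_bigr => i _.
  rewrite (bigD1 (t (l, i) (enum_val q).2)) //= big1 => [|h hg].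
    by rewrite mxE ffunE tK eqxx mulr1 addr0 scalerA [s * _]mulrC.
  rewrite mxE ffunE (_ : ((enum_val q).2 == _) = false) ?mulr0 ?scale0r //.
  by apply/eqP => gh; rewrite gh tK eqxx in hg.
apply: (@le_trans _ _ (l2 (index_enum 'I_n) (fun h => rnorm s * Num.sqrt m%:R *
    hnorm (fun i : J => v (t (l, i) h))))).
  apply: l2_le => h; rewrite hnorm_ge0 /= (hnorm_fourier m_gt0 z_prim (fun i => s *: y i h)) hnormZ mulrA.
  rewrite [_ * rnorm s]mulrC ler_wpM2l ?mulr_ge0 ?rnorm_ge0 // l2_le // => i.
  by rewrite rnorm_ge0 contr_basis.
rewrite l2Z ?mulr_ge0 ?rnorm_ge0 // (l2_pairs (fun _ h => v h)).
rewrite -!mulrA ler_wpM2l ?rnorm_ge0 //.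
have -> : l2 (index_enum 'I_n) (fun h => hnorm (fun _ : J => v h)) =
    Num.sqrt m%:R * hnorm v.
  rewrite -l2Z //; congr Num.sqrt; apply: eq_bigr => h _; congr (_ ^+ 2).
  by rewrite /hnorm /l2 sumr_const card_ord -[X in Num.sqrt X = _]mulr_natl sqrtrM // sqrtr_sqr
    ger0_norm ?rnorm_ge0.
by rewrite mulrA -expr2 sqr_sqrtr.
Qed.

End Contraction.

Lemma head_mx_norm k : (E k (head_mx k) <= (Num.sqrt m%:R ^+ k.+1)%:E)%E.
Proof.
elim: k => [|k IH].
  by apply: max_os_le => // H u h ub u1; exact: head_bound.
apply: (@le_trans _ _ (E k (head_mx k) * E1 (step_mx (odd k.+1)))%E).
  by apply: ereal_inf_lbound; exists #|{: P}|, (head_mx k), (step_mx (odd k.+1));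
    split=> // g q; exact: head_mx_step.
rewrite [in leRHS]exprSr EFinM; apply: lee_pmul => //.
- exact: tower_ge0.
- exact: max_os_ge0.
by apply: max_os_le => // H u h ub u1; exact: step_bound.
Qed.

Lemma test_mx_norm k s :
  (E k.+1 (test_mx k.+1 s) <= (Num.sqrt m%:R ^+ k.+1 * (rnorm s * m%:R))%:E)%E.
Proof.
apply: (@le_trans _ _ (E k (head_mx k) * E1 (tail_mx (odd k.+1) s))%E).
  by apply: ereal_inf_lbound; exists #|{: P}|, (head_mx k), (tail_mx (odd k.+1) s);
    split=> // g q; exact: test_mx_step.
rewrite EFinM; apply: lee_pmul.
- exact: tower_ge0.
- exact: max_os_ge0.
- exact: head_mx_norm.
apply: max_os_le => [|H u h ub u1]; first by rewrite mulr_ge0 ?rnorm_ge0.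
exact: tail_bound.
Qed.

End TestElement.

(** * The dual functional *)
Section Functional.
Variables (R : realType) (m n r k : nat) (z : R[i]) (t : bool * 'I_m -> 'I_n -> 'I_n).
Variables (xi : 'I_r -> ell2 R 'I_n) (M : R).
Hypothesis m_gt0 : (0 < m)%N.
Hypothesis n_gt0 : (0 < n)%N.
Hypothesis z_prim : m.-primitive_root z.
Hypothesis tK : forall a, involutive (t a).
Hypothesis xi_orth : orthonormal_fam xi.
Hypothesis M_gt0 : 0 < M.
Hypothesis trim : forall b h, reduced_supp b ->
  (forall j, hdot (ell2 R 'I_n) h (xi j) = 0) ->
  rnorm (word_comb k.+1 t b h) <= M * wnorm k.+1 b * rnorm h.
Local Notation C := R[i].
Local Notation T := (tpow_idx 'I_m k).
Local Notation V := {ffun T -> C}.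
Local Notation K := (ell2 R 'I_n).
Local Notation N2 := (fun x : V => (l2vec x)%:E).

(** The conjugate phase makes all the terms of the pairing equal, and 1 / M makes
    the functional contractive. *)
Definition dual_coef (I : T) : C := (M^-1)%:C%C * Num.conj (phase z I).

Definition dual_op (a : V) (h : K) : K :=
  \sum_I (dual_coef I * a I) *: word_op t (idx_word I) (proj_away xi h).

Lemma dual_op_linear : linear (dual_op : V -> (K -> K)).
Proof.
move=> c a b; apply/funext => h; rewrite /dual_op.
transitivity (c *: dual_op a h + dual_op b h); last by [].
rewrite /dual_op scaler_sumr -big_split; apply: eq_bigr => I _.
have -> : (c *: a + b) I = c * a I + b I by rewrite !ffunE.
by rewrite mulrDr scalerDl scalerA (mulrCA _ c (a I)).
Qed.
HB.instance Definition _ :=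
  GRing.isLinear.Build C V (K -> K) _ dual_op dual_op_linear.

Lemma proj_away_linear : linear (proj_away xi).
Proof.
move=> c h g; rewrite /proj_away.
have E : \sum_j hdot K (c *: h + g) (xi j) *: xi j =
    c *: (\sum_j hdot K h (xi j) *: xi j) + \sum_j hdot K g (xi j) *: xi j.
  rewrite scaler_sumr -big_split; apply: eq_bigr => j _.
  by rewrite dotDl dotZl scalerDl scalerA.
transitivity (c *: h + g - (c *: (\sum_j hdot K h (xi j) *: xi j) +
  \sum_j hdot K g (xi j) *: xi j)).
  exact: (congr1 (fun y => c *: h + g - y) E).
by rewrite scalerBr opprD addrACA.
Qed.

(** The words of distinct multi-indices are distinct and reduced, so the
    coefficients form a function on reduced words with the same l_2 norm up to
    the factor 1 / M, to which the bound [trim] applies. *)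
Lemma dual_op_le (a : V) (h : K) : rnorm (dual_op a h) <= l2vec a * rnorm h.
Proof.
pose b (u : seq (bool * 'I_m)) : C :=
  \sum_I (u == idx_word I)%:R * (dual_coef I * a I).
have bE (I : T) : b (idx_word I) = dual_coef I * a I.
  rewrite /b (bigD1 I) //= eqxx mul1r big1 ?addr0 // => I' I'I.
  rewrite (_ : (_ == _) = false) ?mul0r //; apply/negbTE.
  by apply: contra I'I => /eqP/idx_word_inj ->.
have b_out u : (forall I : T, u != idx_word I) -> b u = 0.
  by move=> uI; rewrite /b big1 // => I _; rewrite (negbTE (uI I)) mul0r.
have -> : dual_op a h = word_comb k.+1 t b (proj_away xi h).
  rewrite /word_comb.
  transitivity (\sum_(u <- words (bool * 'I_m)%type k.+1) \sum_I
      ((u == idx_word I)%:R * (dual_coef I * a I)) *: word_op t u (proj_away xi h)).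
    rewrite exchange_big; apply: eq_bigr => I _.
    rewrite (bigD1_seq (idx_word I)) ?uniq_words ?mem_words ?size_idx_word //=.
    rewrite eqxx mul1r big1 ?addr0 // => u /negbTE ->.
    by rewrite mul0r scale0r.
  by apply: eq_bigr => u _; rewrite -scaler_suml.
have b_red : reduced_supp b.
  move=> u u_red; apply: b_out => I; apply: contra u_red => /eqP ->.
  exact: idx_word_reduced.
apply: le_trans (trim b_red (proj_away_orth xi_orth h)) _.
apply: ler_pM; rewrite ?mulr_ge0 ?l2_ge0 ?rnorm_ge0 ?(ltW M_gt0) //; last exact: proj_away_le.
rewrite mulrC -ler_pdivlMr // mulrC -l2Z ?invr_ge0 ?(ltW M_gt0) //.
rewrite ler_wsqrtr //.
apply: (@le_trans _ _ (\sum_(u <- words (bool * 'I_m)%type k.+1) \sum_(I : T)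
   (u == idx_word I)%:R * (M^-1 * rnorm (a I)) ^+ 2)).
  apply: ler_sum => u _.
  have [[I ->]|uI] := pselect (exists I : T, u = idx_word I).
    rewrite (bigD1 I) //= eqxx mul1r bE /dual_coef !rnormM rnorm_conj rnorm_real.
    rewrite rnorm_phase // mulr1 ger0_norm ?invr_ge0 ?(ltW M_gt0) // lerDl.
    by apply: sumr_ge0 => I' _; rewrite mulr_ge0 ?sqr_ge0.
  rewrite b_out; last by move=> I; apply/eqP => uE; apply: uI; exists I.
  rewrite rnorm0 expr0n; apply: sumr_ge0 => I _.
  by rewrite mulr_ge0 ?sqr_ge0.
rewrite exchange_big; apply: ler_sum => I _.
rewrite (bigD1_seq (idx_word I)) ?uniq_words ?mem_words ?size_idx_word //=.
by rewrite eqxx mul1r big1 ?addr0 // => u /negbTE ->; rewrite mul0r.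
Qed.

Lemma dual_op_bounded (a : V) : bounded_op (dual_op a).
Proof.
split; last first.
  apply: (@le_lt_trans _ _ (l2vec a)%:E); last exact: ltry.
  by apply: opnorm_leP => [|h]; [exact: l2_ge0 | exact: dual_op_le].
move=> c h g; rewrite /dual_op scaler_sumr -big_split; apply: eq_bigr => I _.
by rewrite proj_away_linear word_op_linear scalerDr !scalerA [_ * c]mulrC.
Qed.

Lemma dual_op_contr : (lin_norm N2 (dual_op : {linear V -> (K -> K)}) <= 1)%E.
Proof.
apply: ge_ereal_sup => _ [a /= a1 <-]; apply: opnorm_leP => // h.
apply: le_trans (dual_op_le a h) _.
by rewrite ler_wpM2r ?rnorm_ge0.
Qed.

Lemma trace_proj : \sum_j entry (proj_away xi (delta R j)) j = n%:R - r%:R.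
Proof.
transitivity (\sum_(j < n) (1 - \sum_k Num.conj (entry (xi k) j) * entry (xi k) j)).
  apply: eq_bigr => j _; rewrite /proj_away entryB deltaE eqxx entry_sum.
  congr (_ - _); apply: eq_bigr => l _.
  by rewrite entryZ dotC dot_delta.
rewrite sumrB sumr_const card_ord; congr (_ - _).
rewrite exchange_big; transitivity (\sum_(l < r) (1 : C)).
  apply: eq_bigr => l _.
  transitivity (hdot K (xi l) (xi l)); last by rewrite xi_orth eqxx.
  rewrite dotE.
  by apply: eq_bigr => j _; rewrite mulrC.
by rewrite sumr_const card_ord.
Qed.

(** Evaluate on the maximally entangled unit vector, the sum of the
    e_g (x) delta_g / sqrt n.  For each I the word operator cancels against the
    permutation matrix of I in the test element, leaving tr(Q) / n with Q the
    projection away from the xi_j. *)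
Lemma pairing (s : R) : 0 <= s ->
  ((M^-1 * s * (m ^ k.+1)%:R * ((n%:R - r%:R) / n%:R))%:E <=
   max_os N2 (test_mx z t k s%:C%C))%E.
Proof.
move=> s0; pose c : C := ((Num.sqrt n%:R)^-1)%:C%C.
have n0 : 0 < n%:R :> R by rewrite ltr0n.
have sn0 : 0 < Num.sqrt n%:R :> R by rewrite sqrtr_gt0.
have cc : c * Num.conj c = (n%:R^-1)%:C%C.
  rewrite conj_mul rnorm_real ger0_norm ?invr_ge0 ?(ltW sn0) //.
  by rewrite exprVn sqr_sqrtr.
pose f (g : 'I_n) : K := c *: delta R g.
have delta1 g : rnorm (delta R g : K) = 1.
  apply/eqP; rewrite -(@eqrXn2 _ 2) ?rnorm_ge0 // expr1n rnorm_ell2.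
  rewrite (bigD1 g) //= deltaE eqxx rnorm1 expr1n big1 ?addr0 // => y yg.
  by rewrite deltaE eq_sym (negbTE yg) rnorm0 expr0n.
have f1 : hnorm f = 1.
  rewrite hnormZ rnorm_real ger0_norm ?invr_ge0 ?(ltW sn0) //.
  rewrite /hnorm /l2; under eq_bigr do rewrite delta1 expr1n.
  by rewrite sumr_const card_ord mulVf // gt_eqF.
pose u : {linear V -> (K -> K)} := dual_op.
pose o := mxapp (map_mx u (test_mx z t k s%:C%C)) f.
apply: (@le_trans _ _ (hnorm o)%:E); last first.
  apply: le_trans (max_os_ge _ dual_op_bounded dual_op_contr).
  by rewrite opnorm_mxE; apply: ereal_sup_ubound; exists f => //=; rewrite f1.
rewrite lee_fin.
have op g h : hdot K (u (test_mx z t k s%:C%C g h) (f h)) (f g) =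
    (n%:R^-1)%:C%C * \sum_(I : T) (M^-1 * s)%:C%C * ((g == move t (idx_word I) h)%:R *
      entry (proj_away xi (delta R h)) h).
  rewrite /f linZ; last by have [] := dual_op_bounded (test_mx z t k s%:C%C g h).
  rewrite dotZl dotZr mulrA cc dot_delta; congr (_ * _).
  rewrite /u /= /dual_op entry_sum; apply: eq_bigr => I _.
  rewrite entryZ word_opE !mxE ffunE.
  case: eqVneq => [->|_]; last by rewrite !(mulr0, mul0r).
  rewrite (moveK tK) mulr1 mul1r /dual_coef; congr (_ * _).
  rewrite mulrACA -rmorphM /= -[RHS]mulr1; congr (_ * _).
  by rewrite mulrC conj_mul rnorm_phase // expr1n.
have total : \sum_g hdot K (o g) (f g) =
    (M^-1 * s * (m ^ k.+1)%:R * ((n%:R - r%:R) / n%:R))%:C%C.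
  transitivity (\sum_h \sum_g hdot K (u (test_mx z t k s%:C%C g h) (f h)) (f g)).
    rewrite [RHS]exchange_big; apply: eq_bigr => g _.
    by rewrite /o /mxapp dot_suml; apply: eq_bigr => h _; rewrite mxE.
  transitivity (\sum_h (n%:R^-1)%:C%C * ((m ^ k.+1)%:R * ((M^-1 * s)%:C%C *
      entry (proj_away xi (delta R h)) h))).
    apply: eq_bigr => h _; under eq_bigr do rewrite op.
    rewrite -mulr_sumr; congr (_ * _); rewrite exchange_big.
    rewrite -[in (m ^ k.+1)%N]card_tpow_idx mulr_natl -sumr_const.
    apply: eq_bigr => I _; rewrite -mulr_sumr; congr (_ * _).
    rewrite (bigD1 (move t (idx_word I) h)) //= eqxx mul1r big1 ?addr0 // => g.
    by move=> /negbTE ->; rewrite mul0r.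
  rewrite -!mulr_sumr trace_proj !rmorphM rmorphB !rmorph_nat.
  by rewrite mulrCA [RHS]mulrC; ring.
have := rnorm_sum (index_enum 'I_n) xpredT (fun g => hdot K (o g) (f g)).
rewrite total rnorm_real => le1; apply: le_trans (ler_norm _) _.
apply: le_trans le1 _.
apply: (@le_trans _ _ (\sum_g rnorm (o g) * rnorm (f g))).
  by apply: ler_sum => g _; exact: Cauchy_Schwarz.
by apply: le_trans (sum_mul_le_l2 _ _ _) _; rewrite -/(hnorm f) f1 mulr1.
Qed.

End Functional.

(** * The two cb norms *)
Section LowerBound.
Variables (R : realType) (m : nat).
Hypothesis m_gt0 : (0 < m)%N.
Local Notation C := R[i].
Local Notation N1 := (fun x : {ffun 'I_m -> C} => (ell1_norm x)%:E).
Local Notation E k := (@haagerup_pow R 'I_m (max_os N1) k).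
Local Notation N2 k := (fun x : {ffun tpow_idx 'I_m k -> C} => (l2vec x)%:E).

Lemma cbnorm_id_ge (J : finType) (F : mxnorms {ffun J -> C}) N n
    (x : 'M[{ffun J -> C}]_n) :
  (F n n x <= 1)%E -> (max_os N x <= cbnorm F (max_os N) idfun)%E.
Proof.
move=> x1; apply: ereal_sup_ubound; exists n, x; split=> //.
by congr (max_os N _); apply/matrixP => i j; rewrite mxE.
Qed.

Lemma cbnorm_ge1 : (1 <= cbnorm (E 0) (max_os (N2 0)) idfun)%E.
Proof.
pose i0 : 'I_m := Ordinal m_gt0.
apply: le_trans (cbnorm_id_ge (N2 0) (ell1_basis R i0)).
have l2_1 : l2vec (basis_vec R i0) = 1.
  rewrite /l2vec /l2 (bigD1 i0) //= big1 => [|i ii0].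
    by rewrite ffunE eqxx rnorm1 expr1n addr0 sqrtr1.
  by rewrite ffunE eq_sym (negbTE ii0) rnorm0 expr0n.
rewrite -[leLHS]/(1%R%:E) -l2_1.
apply: (l2_le_base (E := max_os (N2 0))).
by apply: max_os_col => b; exact: lexx.
Qed.

(** For k = 0 this is an equality; the constants 5/3 and 11/12 of [nearly_free]
    were chosen for it. *)
Lemma four_pow_ge k : k.+2%:R + 5%:R / 3%:R <= 4%:R ^+ k.+1 * (11%:R / 12%:R) :> R.
Proof.
elim: k => [|k IH]; first by rewrite expr1; lra.
rewrite exprS -mulrA -natr1.
have : 0 <= k%:R :> R by [].
have -> : k.+2%:R = k%:R + 2%:R :> R by rewrite -natrD addn2.
move: IH; have -> : k.+2%:R = k%:R + 2%:R :> R by rewrite -natrD addn2.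
lra.
Qed.

Lemma cbnorm_ge_four_pow k :
  ((4%:R ^- k.+1 * Num.sqrt m%:R ^+ k.+1)%:E <=
   cbnorm (E k.+1) (max_os (N2 k.+1)) idfun)%E.
Proof.
have [n [t [r [xi [n0 tK xi_orth r_le trim]]]]] :=
  nearly_free R (bool * 'I_m)%type k.+2.
have [z z_prim] := prim_root_ex R m_gt0.
pose M : R := k.+2%:R + 5%:R / 3%:R.
have k0 : 0 <= k.+2%:R :> R by [].
have M0 : 0 < M by rewrite /M; lra.
pose q : R := Num.sqrt m%:R.
have q0 : 0 < q by rewrite sqrtr_gt0 ltr0n.
have qq : q * q = m%:R by rewrite -expr2 sqr_sqrtr.
(* The scalar that makes the bound of [test_mx_norm] equal to 1. *)
pose s : R := (q ^+ k.+1 * m%:R)^-1.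
have s_pos : 0 < s by rewrite invr_gt0 mulr_gt0 ?exprn_gt0 ?ltr0n.
have x1 : (E k.+1 (test_mx z t k.+1 s%:C%C) <= 1)%E.
  apply: le_trans (test_mx_norm m_gt0 z_prim tK k _) _.
  rewrite lee_fin rnorm_real ger0_norm ?(ltW s_pos) // -/q.
  rewrite mulrCA mulVf // mulf_neq0 ?expf_neq0 ?gt_eqF ?ltr0n //.
apply: le_trans (cbnorm_id_ge (N2 k.+1) x1).
apply: le_trans (pairing m_gt0 n0 z_prim tK xi_orth M0 trim (ltW s_pos)).
rewrite lee_fin.
have -> : M^-1 * s * (m ^ k.+2)%:R = M^-1 * q ^+ k.+1.
  rewrite -mulrA; congr (_ * _); rewrite natrX exprSr -qq exprMn.
  rewrite /s -qq; field.
  by rewrite expf_neq0 gt_eqF.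
have n0' : 0 < n%:R :> R by rewrite ltr0n.
have frac : 11%:R / 12%:R <= (n%:R - r%:R) / n%:R :> R.
  rewrite ler_pdivlMr //; lra.
rewrite mulrAC ler_wpM2r ?exprn_ge0 ?(ltW q0) //.
apply: (@le_trans _ _ (M^-1 * (11%:R / 12%:R))); last by rewrite ler_wpM2l ?invr_ge0 ?(ltW M0).
rewrite mulrC ler_pdivlMr // mulrC ler_pdivrMr ?exprn_gt0 // mulrC.
exact: four_pow_ge.
Qed.

End LowerBound.

Lemma powR_half (R : realType) (m d : nat) : (1 <= d)%N ->
  m%:R `^ ((d%:R - 1) / 2) = Num.sqrt m%:R ^+ d.-1 :> R.
Proof.
case: d => // k _; rewrite -natr1 addrK mulrC powRrM powR12_sqrt //.
by rewrite powR_mulrn.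
Qed.

Theorem theorem0p2 (R : realType) (m d : nat) (hm : (1 <= m)%N) (hd : (1 <= d)%N) :
  let lower : R := 2 ^- (2 * (d - 1)) * m%:R `^ ((d%:R - 1) / 2) in
  let upper : R := m%:R `^ ((d%:R - 1) / 2) in
  (lower%:E
     <= cbnorm (Emd R m d)
               (max_os (fun x => (ell2_tens_norm R m d x)%:E))
               idfun
     <= upper%:E)%E
  /\
  (lower%:E
     <= cbnorm (Emd R m d)
               (max_os (base_norm (Emd R m d)))
               idfun
     <= upper%:E)%E.
Proof.
move=> lower upper.
have upper_le : (cbnorm (Emd R m d) (max_os (base_norm (Emd R m d))) idfun <= upper%:E)%E.
  rewrite /upper powR_half //; apply: cbnorm_max_le.
  - by rewrite exprn_ge0.
  - by move=> n p x; exact: tower_ge0.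
  - exact: tower_extension.
have N2E : (fun x => (ell2_tens_norm R m d x)%:E) = (fun x => (l2vec x)%:E).
  by apply/funext => x; rewrite /ell2_tens_norm dot_norm_l2.
have mono : (cbnorm (Emd R m d) (max_os (fun x => (ell2_tens_norm R m d x)%:E)) idfun
    <= cbnorm (Emd R m d) (max_os (base_norm (Emd R m d))) idfun)%E.
  apply: cbnorm_max_mono => b; rewrite /ell2_tens_norm dot_norm_l2.
  exact: l2_le_tower.
have lower_le : (lower%:E
    <= cbnorm (Emd R m d) (max_os (fun x => (ell2_tens_norm R m d x)%:E)) idfun)%E.
  rewrite N2E /lower powR_half //.
  case: d hd {lower upper upper_le N2E mono} => [//|[|k]] _.
    rewrite muln0 expr0 invr1 mul1r /=; exact: cbnorm_ge1.
  rewrite subn1 /= exprM -natrX; exact: cbnorm_ge_four_pow.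
split; apply/andP; split.
- exact: lower_le.
- exact: le_trans mono upper_le.
- exact: le_trans lower_le mono.
- exact: upper_le.
Qed.
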